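(* Let $K$ be a field of characteristic $0$, let $n\ge 1$ be a natural number, and let $b\in P_n$. If $b$ is random, then $b$ is irreducible in $K((\mathbb{R}^{\le 0}))$.
   Context: $K((\mathbb{R}^{\le 0}))$ is the ring of generalized power series $b=\sum_{\gamma\in\mathbb{R}^{\le 0}}b_\gamma t^\gamma$ with $b_\gamma\in K$ whose support $\operatorname{supp}(b)=\{\gamma: b_\gamma\ne 0\}$ is well-ordered, with the usual sum and product. For an ordinal $\alpha$, $P_\alpha$ is the set of $b\in K((\mathbb{R}^{\le 0}))$ whose support has order type $\omega^\alpha$ and supremum $0$. A series $b$ is random if at least one of the following holds: (a) $\operatorname{cl}(\operatorname{supp}(b))\setminus\{0\}$ is a $\mathbb{Q}$-linearly independent set, where $\operatorname{cl}$ is the topological closure in $\mathbb{R}$; (b) the tuple $\langle b_\gamma:\gamma\in\operatorname{supp}(b)\rangle$ is algebraically independent over $\mathbb{Q}$. Irreducible means nonzero, non-unit, and not a product of two non-units. *)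

(* Defs.v *)
From HB Require Import structures.
From mathcomp Require Import all_boot all_order all_algebra.
From mathcomp Require Import all_classical all_reals topology normedtype.
From mathcomp Require wochoice mpoly.
Import -(notations) mpoly.
Set Implicit Arguments.
Unset Strict Implicit.
Unset Printing Implicit Defensive.
Import Order.TTheory GRing.Theory Num.Theory.
Import numFieldNormedType.Exports.
Local Open Scope classical_set_scope.
Local Open Scope ring_scope.

Section WellOrderedSets.
Context {R : realType}.
Implicit Types A B C : set R.

Definition well_ordered A := wochoice.wo_chain <=%R [in A].

Lemma well_orderedP A :
  well_ordered A <->
  forall B, B `<=` A -> B !=set0 -> exists2 m, B m & lbound B m.
Proof.
split=> [woA B BA [x Bx]|woA].
  have [|m [[mB lbm] _]] := woA [in B] _ (ex_intro _ x (mem_set Bx)).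
    by move=> y yB; apply/mem_set/BA/set_mem.
  by exists m; [exact: set_mem|move=> y By; exact/lbm/mem_set].
apply: wochoice.antisymmetric_wo_chain; first by move=> x y _ _ /le_anti.
move=> B BA [x xB]; have [||m mB lbm] := woA [set` B].
- by move=> y yB; apply/set_mem/BA.
- by exists x.
- by exists m; split => // y yB; apply: lbm.
Qed.

Lemma well_orderedS A B : B `<=` A -> well_ordered A -> well_ordered B.
Proof.
move=> BA /well_orderedP woA; apply/well_orderedP => C CB.
exact: woA (subset_trans CB BA).
Qed.

Lemma well_ordered0 : well_ordered set0.
Proof. by apply/well_orderedP => B B0 [x /B0]. Qed.

Lemma well_ordered1 x : well_ordered [set x].
Proof.
apply/well_orderedP => B B1 [y By]; exists y => // z Bz.
by rewrite (B1 _ By) (B1 _ Bz).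
Qed.

Lemma well_orderedU A B :
  well_ordered A -> well_ordered B -> well_ordered (A `|` B).
Proof.
move=> /well_orderedP woA /well_orderedP woB; apply/well_orderedP => C CAB C0.
have [[x [Cx Ax]]|CA0] := pselect (C `&` A !=set0); last first.
  apply: woB => // x Cx; have [Ax|//] := CAB _ Cx.
  by exfalso; apply: CA0; exists x.
have [[y [Cy By]]|CB0] := pselect (C `&` B !=set0); last first.
  apply: woA => // y Cy; have [//|By] := CAB _ Cy.
  by exfalso; apply: CB0; exists y.
have [||a [Ca Aa] lba] := woA (C `&` A); [exact: subIsetr|by exists x|].
have [||b [Cb Bb] lbb] := woB (C `&` B); [exact: subIsetr|by exists y|].
exists (Num.min a b); first by case: leP.
by move=> z Cz; rewrite ge_min; have [Az|Bz] := CAB _ Cz;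
  [rewrite lba|rewrite lbb ?orbT].
Qed.

Definition sumset A B : set R := [set x + y | x in A & y in B].

Lemma well_ordered_sumset A B :
  well_ordered A -> well_ordered B -> well_ordered (sumset A B).
Proof.
move=> /well_orderedP woA /well_orderedP woB; apply/well_orderedP => C CAB [c0 Cc0].
apply: contrapT => nomin.
have descend c : C c -> exists2 c', C c' & c' < c.
  move=> Cc; apply: contrapT => nc; apply: nomin; exists c => // d Cd.
  by rewrite leNgt; apply/negP => dc; apply: nc; exists d.
pose good b a := [/\ A a, B b, C (a + b) &
  forall a' b', A a' -> B b' -> C (a' + b') -> a' + b' <= a + b -> a <= a'].
have goodP c : C c -> exists a b, good b a /\ a + b <= c.
  move=> Cc.
  have [||a [Aa [b [Bb Cab abc]]] lba] :=
      woA [set a | A a /\ exists b, [/\ B b, C (a + b) & a + b <= c]].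
  - by move=> a [].
  - by have [a Aa [b Bb abc]] := CAB _ Cc; exists a; split => //; exists b; rewrite abc.
  exists a, b; split => //; split => // a' b' Aa' Bb' Cab' le_ab; apply: lba.
  by split => //; exists b'; split => //; exact: le_trans abc.
have [||b [a [Aa Bb Cab mina]] lbb] := woB [set b | exists a, good b a].
- by move=> b [a []].
- by have [a [b [gab _]]] := goodP _ Cc0; exists b, a.
have [c' Cc' lt_c'] := descend _ Cab.
have [a1 [b1 [gab1 le_c']]] := goodP _ Cc'.
have [Aa1 Bb1 Cab1 _] := gab1.
have lt_ab := le_lt_trans le_c' lt_c'.
have lea : a <= a1 by apply: mina (ltW lt_ab).
have leb : b <= b1 by apply: lbb; exists a1.
by move: lt_ab; rewrite ltNge lerD.
Qed.

Lemma well_ordered_finite A :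
  well_ordered A -> well_ordered (-%R @` A) -> finite_set A.
Proof.
move=> /well_orderedP woA /well_orderedP woNA; apply: contrapT => infA.
have maxA B : B `<=` A -> B !=set0 -> exists2 m, B m & ubound B m.
  move=> BA [x Bx]; have [||_ [m Bm <-] lbm] := woNA (-%R @` B).
  - exact: image_subset.
  - by exists (- x), x.
  - by exists m => // y By; rewrite -lerN2; apply: lbm; exists y.
pose T := [set x | A x /\ infinite_set (A `&` [set y | y <= x])].
have A0 : A !=set0 by apply/set0P/eqP => A0; apply: infA; rewrite A0.
have [m Am ubm] := maxA _ (@subset_refl _ A) A0.
have [||x [Ax infx] lbx] := woA T.
- by move=> ? [].
- exists m; split => //; suff -> : A `&` [set y | y <= m] = A by [].
  by apply/seteqP; split => [? []|y Ay] //; split => //; exact: ubm.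
pose L := A `&` [set y | y < x].
have infL : infinite_set L.
  move=> finL; apply: infx; apply: (@sub_finite_set _ _ (L `|` [set x])).
    move=> y [Ay] /=; rewrite le_eqVlt => /orP[/eqP ->|yx]; first by right.
    by left.
  by rewrite finite_setU.
have [||y [Ay yx] uby] := maxA L; first exact: subIsetl.
  by apply/set0P/eqP => L0; apply: infL; rewrite L0.
have : x <= y; last by rewrite leNgt yx.
apply: lbx; split=> // finy; apply: infL; apply: sub_finite_set finy.
by move=> z Lz; split; [case: Lz|exact: uby].
Qed.

Lemma finite_convolution A B e : well_ordered A -> well_ordered B ->
  finite_set [set g | A g /\ B (e - g)].
Proof.
move=> woA /well_orderedP woB; apply: well_ordered_finite.
  by apply: well_orderedS woA => g [].
apply/well_orderedP => C CAB [x Cx].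
have [||b [c Cc <-] lbb] := woB [set e + c | c in C].
- by move=> _ [c Cc <-]; have [g [_ Bg] <-] := CAB _ Cc.
- by exists (e + x), x.
- by exists c => // d Cd; rewrite -(lerD2l e); apply: lbb; exists d.
Qed.

End WellOrderedSets.

Section HahnRing.
Variables (R : realType) (K : fieldType).
Implicit Types b c d : R -> K.

Definition supp b : set R := [set g | b g != 0].

Definition hahn_pred : {pred R -> K} :=
  [pred b | `[< supp b `<=` [set g | g <= 0] /\ well_ordered (supp b) >]].

Lemma hahn_predP b : reflect
  (supp b `<=` [set g | g <= 0] /\ well_ordered (supp b)) (b \in hahn_pred).
Proof. exact: asboolP. Qed.

Lemma hahn_zmod_closed : zmod_closed hahn_pred.
Proof.
split.
  apply/hahn_predP.
  have -> : supp (0 : R -> K) = set0 by apply/seteqP; split => // x; rewrite /supp /= eqxx.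
  by split; [exact: sub0set|exact: well_ordered0].
move=> b c /hahn_predP[b0 wob] /hahn_predP[c0 woc]; apply/hahn_predP.
have sub : supp (b - c) `<=` supp b `|` supp c.
  move=> g; rewrite /supp /= => bc; have [b0g|] := eqVneq (b g) 0; last by left.
  right; apply: contra_neq bc => c0g.
  by rewrite -[LHS]/(b g - c g) b0g c0g subr0.
split; first by move=> g /sub[/b0|/c0].
exact: well_orderedS sub (well_orderedU wob woc).
Qed.

HB.instance Definition _ :=
  GRing.isZmodClosed.Build (R -> K) hahn_pred hahn_zmod_closed.

(* The series of K((R^{<=0})), given by their coefficient functions. *)
Record hahn := Hahn { coef :> R -> K; _ : coef \in hahn_pred }.

HB.instance Definition _ := [isSub for coef].
HB.instance Definition _ := [Choice of hahn by <:].
HB.instance Definition _ := [SubChoice_isSubZmodule of hahn by <:].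

Lemma hahn_le0 (b : hahn) g : supp b g -> g <= 0.
Proof. by case: b => b Hb; have /hahn_predP[b0 _] := Hb; apply: b0. Qed.

Lemma hahn_wo (b : hahn) : well_ordered (supp b).
Proof. by case: b => b Hb; have /hahn_predP[] := Hb. Qed.

Lemma coefD (b c : hahn) g : (b + c) g = b g + c g. Proof. by []. Qed.

Lemma hahnP (b c : hahn) : b =1 c -> b = c.
Proof. by move=> /funext bc; apply/val_inj. Qed.

(* \sum_(g \in A) is the sum over the finitely many g in A whose term is
   nonzero; well-ordered supports guarantee this finiteness here. *)
Definition conv b c : R -> K :=
  fun e => \sum_(g \in [set: R]) b g * c (e - g).

Lemma convE (A : set R) b c e :
  [set g | supp b g /\ supp c (e - g)] `<=` A ->
  conv b c e = \sum_(g \in A) b g * c (e - g).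
Proof.
move=> subA; apply/esym/fsbig_widen => // g [_ Ag] /=.
apply/eqP; apply: contra_notT Ag; rewrite mulf_eq0 negb_or => /andP[].
by move=> bg cg; apply: subA.
Qed.

Lemma conv_supp b c : supp (conv b c) `<=` sumset (supp b) (supp c).
Proof.
move=> e; apply: contraPP => nbc; apply/negP; rewrite negbK; apply/eqP/fsbig1.
move=> g _; apply/eqP; apply: contra_notT nbc; rewrite mulf_eq0 negb_or.
by move=> /andP[bg cg]; exists g => //; exists (e - g) => //; rewrite addrC subrK.
Qed.

Lemma conv_hahn (b c : hahn) : conv b c \in hahn_pred.
Proof.
apply/hahn_predP; split.
  move=> e /conv_supp[g bg [h ch <-]] /=.
  by rewrite -[leRHS]addr0 lerD ?(hahn_le0 bg) ?(hahn_le0 ch).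
by apply: well_orderedS (@conv_supp b c) _; apply: well_ordered_sumset; exact: hahn_wo.
Qed.

Definition hahn_mul (b c : hahn) : hahn := Hahn (conv_hahn b c).

Definition one_coef : R -> K := fun g => (g == 0)%:R.

Lemma supp_one_coef : supp one_coef = [set 0].
Proof.
apply/seteqP; split => g; rewrite /supp /one_coef /=.
  by case: (g =P 0) => //= _; rewrite eqxx.
by move=> ->; rewrite eqxx oner_eq0.
Qed.

Lemma one_coef_hahn : one_coef \in hahn_pred.
Proof.
apply/hahn_predP; rewrite supp_one_coef; split; first by move=> _ ->; rewrite /= lexx.
exact: well_ordered1.
Qed.

Definition hahn_one : hahn := Hahn one_coef_hahn.

Lemma hahn_mulC : commutative hahn_mul.
Proof.
move=> b c; apply/hahnP => e /=; rewrite /conv.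
rewrite (@reindex_fsbigT _ _ _ _ _ (fun g => e - g)); last first.
  by exists (fun g => e - g) => g; rewrite subKr.
by apply: eq_fsbigr => g _; rewrite subKr mulrC.
Qed.

Lemma hahn_mul1 : left_id hahn_one hahn_mul.
Proof.
move=> b; apply/hahnP => e /=; rewrite (@convE [set 0]).
  by rewrite fsbig_set1 /one_coef eqxx mul1r subr0.
by rewrite supp_one_coef => g [].
Qed.

Lemma hahn_mulDl : left_distributive hahn_mul +%R.
Proof.
move=> b c d; apply/hahnP => e; rewrite coefD /=.
pose A := [set g | (supp b `|` supp c) g /\ supp d (e - g)].
have finA : finite_set A.
  by apply: finite_convolution; [apply: well_orderedU|]; exact: hahn_wo.
rewrite !(@convE A).
- by rewrite -fsbig_split //; apply: eq_fsbigr => g _; exact: mulrDl.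
- by move=> g [cg dg]; split => //; right.
- by move=> g [bg dg]; split => //; left.
- move=> g [bcg dg]; split => //; apply: contrapT => /not_orP[].
  move=> /negP/negPn/eqP bg /negP/negPn/eqP cg; move/negP: bcg; apply; apply/eqP.
  by rewrite -[LHS]/(b g + c g) bg cg addr0.
Qed.

Lemma hahn_mulA : associative hahn_mul.
Proof.
move=> b c d; apply/hahnP => e /=.
pose G := [set g | supp b g /\ sumset (supp c) (supp d) (e - g)].
pose H := [set h | sumset (supp b) (supp c) h /\ supp d (e - h)].
have finG : finite_set G.
  by apply: finite_convolution; [|apply: well_ordered_sumset]; exact: hahn_wo.
have finH : finite_set H.
  by apply: finite_convolution; [apply: well_ordered_sumset|]; exact: hahn_wo.
transitivity (\sum_(g \in G) \sum_(h \in H) b g * c (h - g) * d (e - h)).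
  rewrite (@convE G); last by move=> g [bg /conv_supp cdg].
  apply: eq_fsbigr => g /set_mem[bg _].
  under [RHS]eq_fsbigr do rewrite -mulrA.
  rewrite -mulr_fsumr; congr (_ * _).
  rewrite /conv (@reindex_fsbigT _ _ _ _ _ (fun h => h - g)); last first.
    by exists (fun h => h + g) => h; rewrite ?subrK ?addrK.
  under eq_fsbigr do rewrite opprB addrA subrK.
  apply/esym/fsbig_widen => // h [_ nHh] /=.
  apply/eqP; apply: contra_notT nHh; rewrite mulf_eq0 negb_or => /andP[cg dg].
  by split => //; exists g => //; exists (h - g) => //; rewrite addrC subrK.
rewrite exchange_fsbig // (@convE H); last by move=> h [/conv_supp bch].
apply: eq_fsbigr => h /set_mem[_ dh]; rewrite -mulr_fsuml; congr (_ * _).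
rewrite (@convE G) // => g [bg cg]; split => //.
by exists (h - g) => //; exists (e - h) => //; rewrite addrC addrA subrK.
Qed.

Lemma hahn_one_neq0 : hahn_one != 0.
Proof.
apply/eqP => /(congr1 (fun b : hahn => b 0)) /eqP.
by rewrite /= /one_coef eqxx oner_eq0.
Qed.

HB.instance Definition _ := GRing.Zmodule_isComNzRing.Build hahn
  hahn_mulA hahn_mulC hahn_mul1 hahn_mulDl hahn_one_neq0.

Definition hahn_unit : pred hahn := [pred b : hahn | `[< exists c : hahn, c * b = 1 >]].
Definition hahn_inv (b : hahn) : hahn := xget b [set c : hahn | c * b = 1].

Lemma hahn_mulVr : {in hahn_unit, left_inverse 1 hahn_inv *%R}.
Proof.
move=> b /asboolP[c cb].
by rewrite /hahn_inv; case: xgetP => [d _ //|/(_ c)]; case.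
Qed.

Lemma hahn_unitP (b c : hahn) : c * b = 1 -> hahn_unit b.
Proof. by move=> cb; apply/asboolP; exists c. Qed.

Lemma hahn_inv_out : {in [predC hahn_unit], hahn_inv =1 id}.
Proof.
move=> b /asboolP nb; rewrite /hahn_inv; case: xgetP => // c _ cb.
by exfalso; apply: nb; exists c.
Qed.

HB.instance Definition _ := GRing.ComNzRing_hasMulInverse.Build hahn
  hahn_mulVr hahn_unitP hahn_inv_out.

End HahnRing.

Definition irreducible (A : comUnitRingType) (x : A) :=
  [/\ x != 0, x \isn't a GRing.unit &
      forall y z, x = y * z -> y \is a GRing.unit \/ z \is a GRing.unit].

(* omega^n is the order type of n-tuples of naturals under the lexicographic
   order with the leftmost entry most significant. *)
Definition order_type_omega_pow (R : realType) (n : nat) (A : set R) :=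
  exists f : n.-tuplelexi nat -> R,
    {mono f : s t / (s <= t)%O >-> s <= t} /\ range f = A.

Definition P_omega_pow (R : realType) (K : fieldType) (n : nat) :
    set (hahn R K) :=
  [set b | order_type_omega_pow n (supp b) /\ sup (supp b) = 0].

Definition Q_lin_indep (R : realType) (A : set R) :=
  forall (m : nat) (x : 'I_m -> R) (q : 'I_m -> rat),
    injective x -> (forall i, A (x i)) ->
    \sum_(i < m) ratr (q i) * x i = 0 -> forall i, q i = 0.

(* Independence of the family (v i), i in A, not of the set of its values:
   equal values at distinct indices violate it. *)
Definition Q_alg_indep (I : Type) (K : fieldType) (A : set I) (v : I -> K) :=
  forall (m : nat) (x : 'I_m -> I) (p : mpoly.mpoly m rat),
    injective x -> (forall i, A (x i)) ->
    mpoly.mmap (@ratr K) (v \o x) p = 0 -> p = 0.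

Definition random (R : realType) (K : fieldType) (b : hahn R K) :=
  Q_lin_indep (closure (supp b) `\ 0) \/ Q_alg_indep (supp b) b.

(* Main.v *)
(* The germ of b at x is the behaviour of b on the left of x, measured by the
   Cantor-Bendixson rank of x in the closure of supp b. Up to germs of smaller
   rank, the germ of a product cd at z is the finite sum of the products of germs
   of c at x and of d at y over x + y = z; so near 0 the operators D_z taking the
   germ at z act as derivations. In characteristic 0 this derivation property
   makes the rank of germs additive, ranks being added as ordinals by the natural
   sum. Hence if b in P_n is cd, the ranks p of c and q of d at 0 satisfy
   p + q = n, and if p = 0 then c is constant.

   Suppose p, q > 0. Applying D_z, with z close to 0, to a sum of products of
   germs of positive rank gives again such a sum, up to a combination of finitely
   many fixed germs; these disappear from a suitable combination of sufficiently
   many D_z. Going down from rank n to rank 1, where there are no such products,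
   we find distinct points x_i of rank 1 and nonzero scalars such that the
   corresponding combination of the germs of b at the x_i is zero. Randomness
   forbids this: in case (a), x_i, x_j, x_i + h and x_j + h cannot all lie in
   cl(supp b) \ {0}; in case (b), some determinant of coefficients
   b(x_i + h_j) does not vanish. *)
Require Import Defs.
From HB Require Import structures.
From mathcomp Require Import all_boot all_order all_algebra.
From mathcomp Require Import all_classical all_reals topology normedtype.
From mathcomp Require mpoly.
Import -(notations) mpoly.
From mathcomp Require Import finmap multiset ring lra zify.
Set Implicit Arguments.
Unset Strict Implicit.
Unset Printing Implicit Defensive.
Import Order.TTheory GRing.Theory Num.Theory.
Import numFieldNormedType.Exports.
Local Open Scope classical_set_scope.
Local Open Scope ring_scope.

(** Nothing bounds the ranks of the factors in advance: their finiteness is itself a consequence of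
    additivity. Ranks therefore live in an abstract [value_order] with two instances: the natural
    numbers, and Hessenberg sums whose exponents are the points of a well-ordered set of reals
    containing every point where a factor has a nonzero germ. The latter has enough values for both
    factors; and since n times the least generator splits only into multiples of that generator, the
    ranks of the factors turn out to be natural numbers.

    In additivity, the upper bound is an easy induction. The obstacle to the lower bound is that the
    two terms of D_z(c) d + c D_z(d) could cancel. Hence the statement is proved for all products c
    d^k at once: a further power of d either isolates D_z(c), or produces k c d^(k-1) D_z(d) as the
    only dominant term, and k is invertible. Which of the two works depends on which rank has the
    smallest exponent, since lowering a rank by its smallest exponent is the cheapest loss. *)

(** Compactness of [a, b] for properties of half-open intervals that can be glued: the supremum of
    the [t] with [Q a t] is reached by [Q]-steps from its left, and a step to its right would pass
    it unless it is [b]. *)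
Lemma real_induction (R : realType) (Q : R -> R -> Prop) (a b : R) : a < b ->
  (forall x y z, a <= x -> x < y -> y < z -> z <= b -> Q x y -> Q y z -> Q x z) ->
  (forall x, a < x <= b -> exists2 e, e < x & forall y, e < y < x -> Q y x) ->
  (forall x, a <= x < b -> exists2 e, x < e & forall y, x < y < e -> Q x y) ->
  Q a b.
Proof.
move=> ab Qtrans Qleft Qright.
pose T := [set t | a <= t <= b /\ (t = a \/ Q a t)].
have Ta : T a by split; [rewrite lexx ltW|left].
have supT : has_sup T by split; [exists a|exists b => t [/andP[]]].
have as_ : a <= sup T by apply: ub_le_sup => //; case: supT.
have sb : sup T <= b by apply: ge_sup => [|t [/andP[]]]; first by exists a.
have Ts : T (sup T).
  split; first by rewrite as_.
  move: as_; rewrite le_eqVlt => /predU1P[->|as_]; first by left.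
  right; have [|e es Qe] := Qleft (sup T); first by rewrite as_.
  have [|t [/andP[at_ tb] Qt] et] := @sup_adherent _ T (sup T - e) _ supT.
    by rewrite subr_gt0.
  move: et; rewrite subKr => et.
  have : t <= sup T by apply: ub_le_sup; [case: supT|split; first by rewrite at_].
  rewrite le_eqVlt => /predU1P[ts|ts].
    by case: Qt => [ta|]; [move: as_; rewrite -ts ta ltxx|rewrite -ts].
  have Qts : Q t (sup T) by apply: Qe; rewrite et.
  case: Qt => [<- //|Qat]; move: at_; rewrite le_eqVlt => /predU1P[-> //|at_].
  exact: Qtrans Qat Qts.
move: sb; rewrite le_eqVlt => /predU1P[sb|sb].
  by case: Ts => _ [sa|]; [move: ab; rewrite -sb sa ltxx|rewrite sb].
have [|e se Qe] := Qright (sup T); first by rewrite as_.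
pose t := ((sup T) + Num.min e b) / 2.
have me : Num.min e b <= e by rewrite ge_min lexx.
have mb : Num.min e b <= b by rewrite ge_min lexx orbT.
have sm : sup T < Num.min e b by rewrite lt_min se.
have st : sup T < t by rewrite /t; lra.
have tm : t < Num.min e b by rewrite /t; lra.
have Qst : Q (sup T) t by apply: Qe; rewrite st (lt_le_trans tm).
suff : t <= sup T by rewrite leNgt st.
apply: ub_le_sup; first by case: supT.
have le_at : a <= t by apply: le_trans as_ (ltW st).
have le_tb : t <= b by apply: ltW; apply: lt_le_trans tm mb.
split; first by rewrite le_at.
right; case: Ts => _ [<- //|Qas].
move: as_; rewrite le_eqVlt => /predU1P[-> //|as_].
exact: Qtrans Qas Qst.
Qed.

(** Addition is commutative and strictly monotone, as the natural sum of ordinals is and their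
    ordinary sum is not. *)
Record value_order (G : nmodType) (lt : G -> G -> Prop) : Prop := ValueOrder {
  vlt_irr : forall a, ~ lt a a;
  vlt_trans : forall b a c, lt a b -> lt b c -> lt a c;
  vlt_total : forall a b, [\/ lt a b, a = b | lt b a];
  vlt_wf : well_founded lt;
  vlt0 : forall a, ~ lt a 0;
  vltD2r : forall c a b, lt a b -> lt (a + c) (b + c) }.

Lemma vlt_leD (G : nmodType) (lt : G -> G -> Prop) a b c d : value_order lt ->
  ~ lt a c -> ~ lt b d -> ~ lt (a + b) (c + d).
Proof.
move=> ltG ac bd abcd; have [//|E|ca] := vlt_total ltG a c.
  have [//|F|db] := vlt_total ltG b d; first by rewrite E F in abcd; exact: vlt_irr ltG _ abcd.
  have := vltD2r ltG a db; rewrite ![_ + a]addrC {1}E => /(vlt_trans ltG abcd).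
  exact: vlt_irr ltG _.
have [//|F|db] := vlt_total ltG b d.
  have := vltD2r ltG d ca; rewrite -{2}F => /(vlt_trans ltG abcd).
  exact: vlt_irr ltG _.
have := vltD2r ltG a db; rewrite ![_ + a]addrC => adab.
have := vlt_trans ltG (vlt_trans ltG abcd (vltD2r ltG d ca)) adab.
exact: vlt_irr ltG _.
Qed.

(** * Ranks of germs *)

Section Germs.
Variables (R : realType) (K : fieldType).
Implicit Types (f g : R -> K) (x y z e h : R).

(** One-sided neighbourhoods suffice, since a well-ordered support leaves a gap to the right of
    every point. The point [x] counts here but not in [rank_le], so an isolated point of the support
    has rank 0 and not a zero germ. *)
Definition germ0 f x := exists2 e, e < x & forall y, e < y <= x -> f y = 0.

Definition germ_eq f x g y :=
  exists2 e, e < 0 & forall h, e < h <= 0 -> f (x + h) = g (y + h).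

Lemma germ_eq_sym f x g y : germ_eq f x g y -> germ_eq g y f x.
Proof. by case=> e e0 fg; exists e => // h /fg. Qed.

Lemma germ_eq_left f x g y : germ_eq f x g y ->
  exists2 e, e < y & forall t, e < t < y -> germ_eq f (x - y + t) g t.
Proof.
case=> e e0 fg; exists (y + e) => [|t /andP[et ty]]; first by lra.
exists (e + y - t); first by lra.
move=> h /andP[eh h0].
have <- : x + (t - y + h) = x - y + t + h by lra.
by rewrite fg; [congr g|]; lra.
Qed.

Lemma germ_eq_germ0 f x g y : germ_eq f x g y -> germ0 f x -> germ0 g y.
Proof.
case=> e e0 fg [e' ex f0]; exists (y + Num.max e (e' - x)).
  by rewrite gtrDl gt_max e0 subr_lt0.
move=> t; case: (leP e (e' - x)) => H /andP[et ty].
  by rewrite -[t](subrKC y) -fg ?f0//; lra.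
by rewrite -[t](subrKC y) -fg ?f0//; lra.
Qed.

Lemma germ0_left f x : germ0 f x ->
  exists2 e, e < x & forall y, e < y < x -> germ0 f y.
Proof.
case=> e ex f0; exists e => // y /andP[ey yx]; exists e => // t /andP[et ty].
by apply: f0; lra.
Qed.

Lemma germ0D f g x : germ0 f x -> germ0 g x -> germ0 (f \+ g) x.
Proof.
case=> e1 e1x f0 [e2 e2x g0]; exists (Num.max e1 e2) => [|y].
  by rewrite gt_max e1x.
by rewrite gt_max => /andP[/andP[ey1 ey2] yx] /=; rewrite f0 ?g0 ?addr0 ?ey1 ?ey2.
Qed.

Lemma germ_eqD0 f g x : germ0 f x -> germ_eq (f \+ g) x g x.
Proof.
case=> e ex f0; exists (e - x); first by lra.
by move=> h /andP[eh h0] /=; rewrite f0 ?add0r//; lra.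
Qed.

Section Rank.
Variables (G : nmodType) (lt : G -> G -> Prop).
Implicit Types a b c : G.

(* The Cantor-Bendixson rank of [x] in the support of [f], seen from the left.
   A zero germ has no rank: it satisfies [rank_le] and [rank_lt] for every [a]. *)
Inductive rank_le f : G -> R -> Prop := RankLe a x e of e < x &
  (forall y, e < y < x -> germ0 f y \/ exists2 b, lt b a & rank_le f b y) :
  rank_le f a x.

Definition rank_lt f a x := germ0 f x \/ exists2 b, lt b a & rank_le f b x.

Definition rank_eq f a x := rank_le f a x /\ ~ rank_lt f a x.

Lemma rank_leP f a x : rank_le f a x <->
  exists2 e, e < x & forall y, e < y < x -> rank_lt f a y.
Proof. by split=> [[{}a {}x e ex H]|[e ex H]]; [exists e|exact: RankLe H]. Qed.

Hypothesis ltG : value_order lt.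
Let lt_trans := vlt_trans ltG.

Lemma rank_lt_mono f a b x : lt a b -> rank_lt f a x -> rank_lt f b x.
Proof. by move=> ab [?|[c ca fc]]; [left|right; exists c => //; exact: lt_trans ab]. Qed.

Lemma rank_le_mono f a b x : lt a b -> rank_le f a x -> rank_le f b x.
Proof.
move=> ab /rank_leP[e ex fe]; apply/rank_leP; exists e => // y /fe.
exact: rank_lt_mono.
Qed.

Lemma germ0_rank_le f a x : germ0 f x -> rank_le f a x.
Proof. by case/germ0_left => e ex f0; apply: RankLe ex _ => y /f0; left. Qed.

Lemma rank_lt_le f a x : rank_lt f a x -> rank_le f a x.
Proof. by case=> [/germ0_rank_le//|[b ba /rank_le_mono]]; apply. Qed.

Lemma germ_eq_rank_le f g a x y :
  germ_eq f x g y -> rank_le f a x -> rank_le g a y.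
Proof.
elim/(well_founded_ind (vlt_wf ltG)): a x y => a IH x y fg /rank_leP[e ex fe].
have [e' e'y fg'] := germ_eq_left fg.
apply/rank_leP; exists (Num.max e' (e + y - x)).
  by rewrite gt_max e'y /=; lra.
move=> t; rewrite gt_max => /andP[/andP[e't et] ty].
have fgt : germ_eq f (x - y + t) g t by apply: fg'; rewrite e't.
have [||[b ba fb]] := fe (x - y + t); first by lra.
  by left; apply: germ_eq_germ0 fgt _.
by right; exists b => //; exact: IH fb.
Qed.

Lemma germ_eq_rank_lt f g a x y :
  germ_eq f x g y -> rank_lt f a x -> rank_lt g a y.
Proof.
move=> fg [/(germ_eq_germ0 fg)|[b ba fb]]; first by left.
by right; exists b => //; exact: germ_eq_rank_le fb.
Qed.

Lemma rank_leD f g a x : rank_le f a x -> rank_le g a x -> rank_le (f \+ g) a x.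
Proof.
elim/(well_founded_ind (vlt_wf ltG)): a x => a IH x.
move=> /rank_leP[e ex fe] /rank_leP[e' e'x ge].
apply/rank_leP; exists (Num.max e e'); first by rewrite gt_max ex.
move=> y; rewrite gt_max => /andP[/andP[ey e'y] yx].
have [||[b ba fb]] := fe y; first by rewrite ey.
  move=> f0; have [||gb] := ge y; first by rewrite e'y.
    by left; apply: germ0D.
  by right; have [b ba gb'] := gb; exists b => //;
    exact: germ_eq_rank_le (germ_eq_sym (germ_eqD0 g f0)) gb'.
have [||[c ca gc]] := ge y; first by rewrite e'y.
  move=> g0; right; exists b => //; rewrite (_ : f \+ g = g \+ f); last first.
    by apply/funext => t /=; rewrite addrC.
  exact: germ_eq_rank_le (germ_eq_sym (germ_eqD0 f g0)) fb.
right; have [bc|bc|cb] := vlt_total ltG b c.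
- by exists c => //; apply: IH => //; apply: rank_le_mono fb.
- by exists b => //; apply: IH => //; rewrite bc.
- by exists b => //; apply: IH => //; apply: rank_le_mono gc.
Qed.

Lemma rank_ltD f g a x : rank_lt f a x -> rank_lt g a x -> rank_lt (f \+ g) a x.
Proof.
move=> [f0|[b ba fb]] [g0|[c ca gc]].
- by left; apply: germ0D.
- by apply: germ_eq_rank_lt (germ_eq_sym (germ_eqD0 g f0)) _; right; exists c.
- rewrite (_ : f \+ g = g \+ f); last by apply/funext => t /=; rewrite addrC.
  by apply: germ_eq_rank_lt (germ_eq_sym (germ_eqD0 f g0)) _; right; exists b.
right; have [bc|bc|cb] := vlt_total ltG b c.
- by exists c => //; apply: rank_leD => //; apply: rank_le_mono fb.
- by exists b => //; apply: rank_leD => //; rewrite bc.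
- by exists b => //; apply: rank_leD => //; apply: rank_le_mono gc.
Qed.

Lemma rank_leZ (k : K) f a x : rank_le f a x -> rank_le (fun y => k * f y) a x.
Proof.
elim/(well_founded_ind (vlt_wf ltG)): a x => a IH x /rank_leP[e ex fe].
apply/rank_leP; exists e => // y /fe[[e' e'y f0]|[b ba fb]].
  by left; exists e' => // t /f0 ->; rewrite mulr0.
by right; exists b => //; apply: IH.
Qed.

Lemma rank_ltZ (k : K) f a x : rank_lt f a x -> rank_lt (fun y => k * f y) a x.
Proof.
move=> [[e' e'y f0]|[b ba fb]].
  by left; exists e' => // t /f0 ->; rewrite mulr0.
by right; exists b => //; apply: rank_leZ.
Qed.

Lemma rank_eq_exists f a x : rank_le f a x -> ~ germ0 f x ->
  exists2 b, ~ lt a b & rank_eq f b x.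
Proof.
elim/(well_founded_ind (vlt_wf ltG)): a => a IH fa f0.
have [[//|[b ba fb]]|fNa] := pselect (rank_lt f a x); last first.
  by exists a => //; apply: vlt_irr.
have [c bc fc] := IH b ba fb f0; exists c => // ac.
exact/bc/(lt_trans ba ac).
Qed.

Lemma rank_eq_inj f a b x : rank_eq f a x -> rank_eq f b x -> a = b.
Proof.
move=> [fa nfa] [fb nfb]; have [ab|//|ba] := vlt_total ltG a b.
- by exfalso; apply: nfb; right; exists a.
- by exfalso; apply: nfa; right; exists b.
Qed.

Lemma rank_gt_left f a x : ~ rank_le f a x ->
  forall e, e < x -> exists2 y, e < y < x & ~ rank_lt f a y.
Proof.
move=> fa e ex; apply: contrapT => H; apply: fa; apply/rank_leP; exists e => // y exy.
by apply: contrapT => fy; apply: H; exists y.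
Qed.

End Rank.
End Germs.

(** * Operations on series *)

Section HahnOperations.
Variables (R : realType) (K : fieldType).
Local Notation H := (hahn R K).
Implicit Types (c d : H) (x y z a b : R).

Lemma hshift_hahn x c : (fun g => if g <= 0 then c (x + g) else 0) \in @hahn_pred R K.
Proof.
apply/hahn_predP; split=> [g|]; first by rewrite /supp /=; case: ifP; rewrite ?eqxx.
have /well_orderedP wo := @hahn_wo R K c.
apply/well_orderedP => C Cs [y Cy].
have [||_ [m Cm <-] lbm] := wo [set x + g | g in C].
- by move=> _ [g /Cs + <-]; rewrite /supp /=; case: ifP; rewrite ?eqxx.
- by exists (x + y), y.
- by exists m => // g Cg; rewrite -(lerD2l x); apply: lbm; exists g.
Qed.

(* The germ of [c] at [x], moved to 0: [t^(-x)] times the part of [c] with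
   exponents at most [x]. *)
Definition hshift x c : H := Hahn (hshift_hahn x c).

Lemma trunc_hahn a b c : (fun g => if a < g <= b then c g else 0) \in @hahn_pred R K.
Proof.
have sub : supp (fun g => if a < g <= b then c g else 0) `<=` supp c.
  by move=> g; rewrite /supp /=; case: ifP; rewrite ?eqxx.
apply/hahn_predP; split=> [g /sub|]; first exact: hahn_le0.
exact: well_orderedS sub (@hahn_wo R K c).
Qed.

(** Half-open intervals make truncations additive under concatenation, as [real_induction]
    requires. *)
Definition trunc a b c : H := Hahn (trunc_hahn a b c).

Lemma const_hahn (k : K) : (fun g : R => if g == 0 then k else 0) \in @hahn_pred R K.
Proof.
have sub : supp (fun g : R => if g == 0 then k else 0) `<=` [set 0].
  by move=> g; rewrite /supp /=; case: (g =P 0); rewrite ?eqxx.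
apply/hahn_predP; split=> [_ /sub ->|]; first by rewrite /= lexx.
exact: well_orderedS sub (@well_ordered1 R 0).
Qed.

Definition const (k : K) : H := Hahn (const_hahn k).

Lemma hshiftE x c g : hshift x c g = if g <= 0 then c (x + g) else 0. Proof. by []. Qed.
Lemma truncE a b c g : trunc a b c g = if a < g <= b then c g else 0.
Proof. by []. Qed.
Lemma coef_zero g : (0 : H) g = 0. Proof. by []. Qed.
Lemma coef_sub c d g : (c - d) g = c g - d g. Proof. by []. Qed.

Lemma coef_gt0 c g : 0 < g -> c g = 0.
Proof.
by move=> g0; apply/eqP; apply: contraTT g0 => /hahn_le0; rewrite /= leNgt.
Qed.

Lemma hshift0 c : hshift 0 c = c.
Proof.
by apply/hahnP => g; rewrite hshiftE add0r; case: leP => // /coef_gt0 ->.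
Qed.

Lemma hshiftD x c d : hshift x (c + d) = hshift x c + hshift x d.
Proof.
by apply/hahnP => g; rewrite Defs.coefD !hshiftE; case: ifP => // _; rewrite addr0.
Qed.

Lemma hshift_sum x (I : Type) (r : seq I) (P : pred I) (F : I -> H) :
  hshift x (\sum_(i <- r | P i) F i) = \sum_(i <- r | P i) hshift x (F i).
Proof.
apply: (big_morph _ (hshiftD x)).
by apply/hahnP => g; rewrite hshiftE coef_zero if_same.
Qed.

Lemma coef_conv (c d c' d' : H) e e' s :
  (forall u, c u * d (e - u) = c' (u - s) * d' (e' - (u - s))) ->
  (c * d) e = (c' * d') e'.
Proof.
move=> E; rewrite -[LHS]/(conv c d e) -[RHS]/(conv c' d' e') /conv.
rewrite [RHS](@reindex_fsbigT _ _ _ _ _ (fun u => u - s)); last first.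
  by exists (fun u => u + s) => u; rewrite ?subrK ?addrK.
exact: eq_fsbigr.
Qed.

Lemma coef_conv0 (c d : H) e : (forall u, c u * d (e - u) = 0) -> (c * d) e = 0.
Proof. by move=> E; rewrite -[LHS]/(conv c d e) /conv fsbig1. Qed.

Lemma coef_const_mul k c g : (const k * c) g = k * c g.
Proof.
rewrite -[LHS]/(conv (const k) c g) (@convE _ _ [set 0]).
  by rewrite fsbig_set1 subr0 /= eqxx.
by move=> u [+ _]; rewrite /supp /=; case: (u =P 0); rewrite ?eqxx.
Qed.

Lemma constM k l : const (k * l) = const k * const l.
Proof. by apply/hahnP => g; rewrite coef_const_mul /=; case: ifP; rewrite ?mulr0. Qed.

Lemma const1 : const 1 = 1.
Proof. by apply/hahnP => g; rewrite /= /one_coef; case: eqP. Qed.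

Lemma const_unit k : k != 0 -> const k \is a GRing.unit.
Proof.
by move=> k0; apply/unitrP; exists (const k^-1); rewrite -!constM mulVf ?divff ?const1.
Qed.

Lemma coefM0 c d : (c * d) 0 = c 0 * d 0.
Proof.
rewrite -[LHS]/(conv c d 0) (@convE _ _ [set 0]); first by rewrite fsbig_set1 subr0.
move=> u [/hahn_le0 /= u0 /hahn_le0 /=]; rewrite sub0r oppr_le0 => u0'.
by apply/eqP; rewrite eq_le u0.
Qed.

Lemma hshift_const_mul x k c : hshift x (const k * c) = const k * hshift x c.
Proof.
by apply/hahnP => g; rewrite coef_const_mul !hshiftE coef_const_mul; case: ifP; rewrite ?mulr0.
Qed.

Lemma hahn_right_zero c x :
  exists2 e, x < e & forall y, x < y < e -> c y = 0.
Proof.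
have /well_orderedP wo := @hahn_wo R K c.
have [[y0 []]|H] := pselect (exists y, supp c y /\ x < y); last first.
  exists (x + 1) => [|y /andP[xy _]]; first by rewrite ltrDl.
  by apply/eqP; apply: contra_notT H => cy; exists y.
move=> cy0 xy0; have [||m [cm xm] lbm] := wo [set y | supp c y /\ x < y].
- by move=> y [].
- by exists y0.
exists m => // y /andP[xy ym]; apply/eqP; apply: contraTT ym => cy.
by rewrite -leNgt; apply: lbm.
Qed.

Lemma hshift_germ x c y : y <= 0 -> germ_eq (hshift x c) y c (x + y).
Proof.
move=> y0; exists (-1) => [|h /andP[_ h0]]; first lra.
by rewrite hshiftE addrA ifT//; lra.
Qed.

Lemma hshift_germ0 x c : germ_eq (hshift x c) 0 c x.
Proof. by have := hshift_germ x c (lexx 0); rewrite addr0. Qed.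

Lemma germ0_mull c d : germ0 c 0 -> germ0 (c * d) 0.
Proof.
case=> e e0 c0; exists e => // y /andP[ey y0]; apply: coef_conv0 => u.
have [yu|uy] := leP u e; last first.
  have [u0|u0] := leP u 0; first by rewrite c0 ?mul0r ?uy.
  by rewrite (coef_gt0 c u0) mul0r.
by rewrite [d _]coef_gt0 ?mulr0//; lra.
Qed.

Lemma germ0_mulr c d : germ0 d 0 -> germ0 (c * d) 0.
Proof. by rewrite mulrC; exact: germ0_mull. Qed.

Lemma germ0_gt0 c x : 0 < x -> germ0 c x.
Proof.
by move=> x0; exists 0 => // y /andP[y0 _]; rewrite coef_gt0.
Qed.

(** Exponents of [c] just below [x] can only meet exponents of [d] near [z - x], and those just
    above [z - x] are absent because of the gap in the support of [d]. *)
Lemma trunc_mul_germ c d z x : exists2 e, e < x & forall a, e < a < x ->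
  germ_eq (trunc a x c * d) z (hshift x c * hshift (z - x) d) 0.
Proof.
have [e zxe d0] := hahn_right_zero d (z - x).
(* For [u > x - eta] and [h <= 0] the partner [z + h - u] stays below [e], hence lies in the gap if
   it exceeds [z - x]. The bound [h > a - x] ensures that the truncation at [a] loses no pair. *)
pose eta := (e - (z - x)) / 2.
have eta0 : 0 < eta by rewrite /eta; lra.
have etae : z - x + eta < e by rewrite /eta; lra.
exists (x - eta) => [|a /andP[ea ax]]; first by lra.
exists (Num.max (- eta) (a - x)).
  by rewrite gt_max; apply/andP; split; lra.
move=> h; rewrite gt_max => /andP[/andP[eh ah] h0].
rewrite add0r; apply: (coef_conv (s := x)) => u; rewrite truncE !hshiftE.
rewrite subrKC (_ : z - x + (h - (u - x)) = z + h - u); last by lra.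
have -> : (u - x <= 0) = (u <= x) by rewrite subr_le0.
have [ux|xu] := leP u x; last by rewrite andbF !mul0r.
rewrite andbT; have [au|ua] := ltP a u.
  have [hux|hux] := leP (h - (u - x)) 0; first by [].
  by rewrite mulr0 d0 ?mulr0//; apply/andP; split; lra.
by rewrite mul0r ifN ?mulr0// -ltNge; lra.
Qed.

End HahnOperations.
Arguments const {R K} k.

(** * Germs of products *)

Section Localization.
Variables (R : realType) (K : fieldType).
Local Notation H := (hahn R K).
Implicit Types (c d : H) (x y z a b : R).

Lemma seq_lt_bound (s : seq R) x : exists2 a, a < x & all (fun t => (t < x) ==> (t < a)) s.
Proof.
elim: s => [|t s [a ax IH]]; first by exists (x - 1) => //; rewrite gtrBl.
have [tx|xt] := ltP t x; last first.
  by exists a => //=; rewrite ltNge xt.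
exists ((Num.max a t + x) / 2).
  by have : Num.max a t < x; [rewrite gt_max ax|lra].
have am : a <= Num.max a t by rewrite le_max lexx.
have tm : t <= Num.max a t by rewrite le_max lexx orbT.
have mx : Num.max a t < x by rewrite gt_max ax.
rewrite /= tx /=; apply/andP; split; first by lra.
apply: sub_all IH => u /implyP ua; apply/implyP => /ua uaa; lra.
Qed.

Lemma seq_gt_bound (s : seq R) x : exists2 a, x < a & all (fun t => (x < t) ==> (a < t)) s.
Proof.
have [a ax H] := seq_lt_bound (map -%R s) (- x).
exists (- a) => [|]; first by lra.
by move: H; rewrite all_map; apply: sub_all => t /=; rewrite ltrN2 ltrNl.
Qed.

Lemma seq_lower_bound (s : seq R) x : exists2 a, a < x & all (fun t => a < t) s.
Proof.
elim: s => [|t s [a ax IH]]; first by exists (x - 1) => //; rewrite gtrBl.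
exists (Num.min a (t - 1)); first by rewrite gt_min ax.
rewrite /= gt_min gtrBl ltr01 orbT /=; apply: sub_all IH => u au.
by rewrite gt_min au.
Qed.

Lemma germ_eq_sub c z d : germ_eq c z d 0 -> germ0 (hshift z c - d) 0.
Proof.
case=> e e0 cd; exists e => // y /andP[ey y0].
by rewrite coef_sub hshiftE y0 cd ?add0r ?subrr// ey.
Qed.

Lemma mul_low_germ0 c d a z : (forall u, a < u -> c u = 0) -> a < z ->
  germ0 (c * d) z.
Proof.
move=> c0 az; exists a => // y /andP[ay _]; apply: coef_conv0 => u.
have [ua|au] := leP u a; last by rewrite c0 ?mul0r.
by rewrite [d _]coef_gt0 ?mulr0//; lra.
Qed.

Variables (G : nmodType) (lt : G -> G -> Prop) (ltG : value_order lt).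
Implicit Types e u v : G.

Lemma hrank_ltD c d e x : rank_lt lt c e x -> rank_lt lt d e x -> rank_lt lt (c + d) e x.
Proof. exact: rank_ltD. Qed.

Lemma hrank_ltZ k c e x : rank_lt lt c e x -> rank_lt lt (const k * c) e x.
Proof.
by move=> /(rank_ltZ ltG k); congr (rank_lt _ _ _ _); apply/funext => y; rewrite coef_const_mul.
Qed.

Lemma hrank_leZ k c e x : rank_le lt c e x -> rank_le lt (const k * c) e x.
Proof.
by move=> /(rank_leZ ltG k); congr (rank_le _ _ _ _); apply/funext => y; rewrite coef_const_mul.
Qed.

Lemma constN1 c : const (- 1) * c = - c.
Proof. by apply/hahnP => g; rewrite coef_const_mul mulN1r. Qed.

Lemma hrank_ltN c e x : rank_lt lt c e x -> rank_lt lt (- c) e x.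
Proof. by rewrite -constN1; exact: hrank_ltZ. Qed.

Lemma hrank_ltB c d e x : rank_lt lt c e x -> rank_lt lt d e x -> rank_lt lt (c - d) e x.
Proof. by move=> ? ?; apply/hrank_ltD/hrank_ltN. Qed.

Lemma hrank_lt0 e x : rank_lt lt (0 : H) e x.
Proof. by left; exists (x - 1) => //; rewrite gtrBl. Qed.

Lemma hrank_lt_sum e x (I : eqType) (r : seq I) (P : pred I) (F : I -> H) :
  (forall i, i \in r -> P i -> rank_lt lt (F i) e x) ->
  rank_lt lt (\sum_(i <- r | P i) F i) e x.
Proof.
move=> FP; rewrite big_seq_cond.
by apply: (big_ind (fun f : H => rank_lt lt f e x)) => [|c d|i /andP[/FP]];
  [exact: hrank_lt0|exact: hrank_ltD|apply].
Qed.

Lemma rank_lt_hshift c e x : rank_lt lt (hshift x c) e 0 <-> rank_lt lt c e x.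
Proof.
split; first exact: germ_eq_rank_lt (hshift_germ0 x c).
exact: germ_eq_rank_lt (germ_eq_sym (hshift_germ0 x c)).
Qed.

Lemma rank_le_hshift c e x : rank_le lt (hshift x c) e 0 <-> rank_le lt c e x.
Proof.
split; first exact: germ_eq_rank_le (hshift_germ0 x c).
exact: germ_eq_rank_le (germ_eq_sym (hshift_germ0 x c)).
Qed.

Lemma germ0_hshift c x : germ0 (hshift x c) 0 <-> germ0 c x.
Proof.
split; first exact: germ_eq_germ0 (hshift_germ0 x c).
exact: germ_eq_germ0 (germ_eq_sym (hshift_germ0 x c)).
Qed.

(* Berarducci's convolution formula for germs, modulo germs of small rank:
   by compactness only the pairs [(x, z - x)] with [x] in [s] contribute. *)
Lemma mul_local e (s : seq R) c d z : uniq s ->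
  (forall x, x \notin s -> rank_lt lt (hshift x c * hshift (z - x) d) e 0) ->
  rank_lt lt (hshift z (c * d) - \sum_(x <- s) hshift x c * hshift (z - x) d) e 0.
Proof.
move=> us small; pose T x := hshift x c * hshift (z - x) d.
have [a az as_] := seq_lower_bound s z.
have [b b0 bs] := seq_lower_bound (map -%R s) (Num.min 0 (- z)).
move: b0; rewrite lt_min => /andP[b0 bz].
have {bs} bs : all (fun t => t < - b) s.
  by move: bs; rewrite all_map; apply: sub_all => t /=; rewrite ltrNr.
(* The formula for the part of [c] in []x, y]]. Here [a] is below [z] and [s], and [- b] is above 0,
   [z] and [s]; what [c] has outside []a, - b]] lies at or below [a], too low to reach a
   neighbourhood of [z]. *)
pose Q x y := rank_lt lt (hshift z (trunc x y c * d) - \sum_(t <- s | x < t <= y) T t) e 0.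
have Qab : Q a (- b).
  apply: real_induction; first by lra.
  - move=> x y w _ xy yw _ Qxy Qyw; rewrite /Q.
    have -> : trunc x w c = trunc x y c + trunc y w c.
      apply/hahnP => t; rewrite Defs.coefD !truncE.
      have [ty|yt] := leP t y; rewrite ?andbT ?andbF /=.
        by rewrite addr0 (le_trans ty (ltW yw)) andbT.
      by rewrite add0r (lt_trans xy yt).
    rewrite mulrDl hshiftD (bigID (fun t => t <= y)) opprD addrACA.
    congr (rank_lt _ _ _ _): (hrank_ltD Qxy Qyw).
    congr (coef (_ - _ + (_ - _))); apply: eq_bigl => t /=.
      have [ty|yt] := leP t y; rewrite ?andbT ?andbF //=.
      by rewrite (le_trans ty (ltW yw)) andbT.
    have [ty|yt] := leP t y; rewrite ?andbT ?andbF //=.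
    by rewrite (lt_trans xy yt).
  (* For a short interval ending at [x] the germ is exactly [T x]: it is subtracted if [x] is in [s]
     and small otherwise. *)
  - move=> x _; have [e1 e1x g1] := trunc_mul_germ c d z x.
    have [e2 e2x s2] := seq_lt_bound s x.
    exists (Num.max e1 e2) => [|y]; first by rewrite gt_max e1x.
    rewrite gt_max => /andP[/andP[e1y e2y] yx].
    have g : germ_eq (trunc y x c * d) z (T x) 0 by apply: g1; rewrite e1y.
    have -> : Q y x = rank_lt lt (hshift z (trunc y x c * d) - \sum_(t <- s | t == x) T t) e 0.
      congr (rank_lt _ (coef (_ - _)) _ _).
      rewrite big_seq_cond [RHS]big_seq_cond; apply: eq_bigl => t.
      case: (boolP (t \in s)) => //= ts; have := allP s2 _ ts.
      case: ltgtP => [tx /= te2|xt _|->]; rewrite ?andbF ?yx//.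
      by rewrite andbT; apply/negbTE; rewrite -leNgt (ltW (lt_trans te2 e2y)).
    case: (boolP (x \in s)) => xs.
      have -> : \sum_(t <- s | t == x) T t = T x.
        rewrite (big_rem x) //= eqxx big1_seq ?addr0 // => t.
        by rewrite mem_rem_uniq // inE => /andP[/eqP -> /andP[/eqP]].
      by left; apply: germ_eq_sub.
    rewrite big1_seq ?subr0; last by move=> t /andP[/eqP ->]; rewrite (negbTE xs).
    apply/rank_lt_hshift; apply: germ_eq_rank_lt (germ_eq_sym g) _ => //.
    exact: small.
  - move=> x _; have [e1 xe1 c0] := hahn_right_zero c x.
    have [e2 xe2 s2] := seq_gt_bound s x.
    exists (Num.min e1 e2) => [|y]; first by rewrite lt_min xe1.
    rewrite lt_min => /andP[xy /andP[ye1 ye2]].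
    rewrite /Q (_ : trunc x y c = 0) ?mul0r; last first.
      apply/hahnP => t; rewrite truncE coef_zero; case: ifP => // /andP[xt ty].
      by rewrite c0 // xt (le_lt_trans ty).
    rewrite (_ : hshift z 0 = 0); last by apply/hahnP => t; rewrite hshiftE coef_zero if_same.
    rewrite big1_seq ?subr0; first exact: hrank_lt0.
    move=> t /andP[/andP[xt ty] ts]; have := allP s2 _ ts; rewrite xt /= => e2t.
    by move: (lt_le_trans (lt_trans ye2 e2t) ty); rewrite ltxx.
have -> : \sum_(x <- s) hshift x c * hshift (z - x) d = \sum_(t <- s | a < t <= - b) T t.
  rewrite big_seq [RHS]big_seq_cond; apply: eq_bigl => t.
  case: (boolP (t \in s)) => //= ts.
  by have -> := allP as_ _ ts; rewrite (ltW (allP bs _ ts)).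
rewrite -[c in c * d](subrK (trunc a (- b) c)) mulrDl hshiftD -addrA.
apply: hrank_ltD Qab; apply/rank_lt_hshift; left; apply: mul_low_germ0 (az) => u au.
rewrite coef_sub truncE au /=; case: leP => [|bu]; first by rewrite subrr.
by rewrite subr0 coef_gt0//; lra.
Qed.

(** Apply [mul_local] with the empty list. For [z < 0] close to 0, two points [x], [z - x] that are
    at most 0 both lie in [[z, 0]] and are not both 0, so at least one of the two ranks has
    dropped. *)
Lemma rank_le_mul u v c d : rank_le lt c u 0 -> rank_le lt d v 0 ->
  rank_le lt (c * d) (u + v) 0.
Proof.
elim/(well_founded_ind (vlt_wf ltG)): u v c d => u IHu v.
elim/(well_founded_ind (vlt_wf ltG)): v => v IHv c d cu dv.
have /rank_leP[e e0 ce] := cu; have /rank_leP[e' e'0 de] := dv.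
apply/rank_leP; exists (Num.max e e'); first by rewrite gt_max e0.
move=> z; rewrite gt_max => /andP[/andP[ez e'z] z0].
have ltD u' v' : lt u' u -> lt v' v -> lt (u' + v') (u + v).
  move=> u'u v'v; apply: vlt_trans (vltD2r ltG v' u'u) _ => //.
  by rewrite addrC [u + v]addrC; apply: vltD2r.
have := @mul_local (u + v) [::] c d z isT; rewrite big_nil subr0 => cd.
apply/rank_lt_hshift/cd => x _.
have [xz|zx] := ltP x z.
  by left; apply/germ0_mulr/germ0_hshift/germ0_gt0; rewrite subr_gt0.
have [x0|x0] := ltP 0 x.
  by left; apply/germ0_mull/germ0_hshift/germ0_gt0.
move: zx; rewrite le_eqVlt => /predU1P[<-|zx].
  rewrite subrr hshift0.
  have [c0|[u' u'u cu']] : rank_lt lt (hshift z c) u 0.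
  - by apply/rank_lt_hshift/ce; rewrite ez.
  - by left; apply: germ0_mull.
  by right; exists (u' + v); [exact: vltD2r|exact: IHu].
have [d0|[v' v'v dv']] : rank_lt lt (hshift (z - x) d) v 0.
- move: x0; rewrite le_eqVlt => /predU1P[->|x0].
    by rewrite subr0; apply/rank_lt_hshift/de; rewrite e'z.
  by apply/rank_lt_hshift/de; lra.
- by left; apply: germ0_mulr.
move: x0; rewrite le_eqVlt => /predU1P[x0|x0].
  rewrite x0 hshift0 in dv' *; right; exists (u + v'); last exact: IHv.
  by rewrite addrC [u + v]addrC; apply: vltD2r.
have [c0|[u' u'u cu']] : rank_lt lt (hshift x c) u 0.
- by apply/rank_lt_hshift/ce; lra.
- by left; apply: germ0_mull.
by right; exists (u' + v'); [exact: ltD|exact: IHu].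
Qed.

End Localization.

(** * Hessenberg sums *)

Section Hessenberg.
Variables (d : Order.disp_t) (E : orderType d).

(* Ordinals below omega^E in Cantor normal form: a multiset records the
   exponents, and the sum of multisets is the Hessenberg (natural) sum. *)
Definition hessenberg := {mset E}%mset.
HB.instance Definition _ := Choice.on hessenberg.

Lemma hess_addA : associative (@msetD E : hessenberg -> hessenberg -> hessenberg).
Proof. by move=> a b c; rewrite msetDA. Qed.

Lemma hess_addC : commutative (@msetD E : hessenberg -> hessenberg -> hessenberg).
Proof. by move=> a b; rewrite msetDC. Qed.

Lemma hess_add0 : left_id (@mset0 E : hessenberg) (@msetD E).
Proof. by move=> a; rewrite mset0D. Qed.

HB.instance Definition _ := GRing.isNmodule.Build hessenberg hess_addA hess_addC hess_add0.

Definition mult (a : hessenberg) (e : E) : nat := (a : {mset E}%mset) e.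
Definition omega_pow (e : E) : hessenberg := [mset e]%mset.
Implicit Types (a b c : hessenberg) (e x y : E).

Lemma hessP a b : mult a =1 mult b -> a = b. Proof. by move/msetP. Qed.

Lemma multD a b e : mult (a + b) e = (mult a e + mult b e)%N.
Proof. by rewrite /mult [a + b]/(msetD a b) msetE2. Qed.

Lemma mult0 e : mult 0 e = 0%N. Proof. by rewrite /mult [0]/(mset0) mset0E. Qed.

Lemma mult1 x e : mult (omega_pow x) e = (e == x).
Proof. by rewrite /mult msetnE; case: eqP. Qed.

Lemma multMn a n e : mult (a *+ n) e = (n * mult a e)%N.
Proof. by elim: n => [|n IH]; rewrite ?mulr0n ?mult0 // mulrS multD IH mulSn. Qed.

Definition mfun (s : seq E) (f : E -> nat) : hessenberg :=
  \sum_(e <- undup s) omega_pow e *+ f e.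

Lemma mult_fun s f e : mult (mfun s f) e = if e \in s then f e else 0%N.
Proof.
rewrite /mfun (big_morph (fun a => mult a e) (fun a b => multD a b e) (mult0 e)).
case: ifP => es.
  rewrite (big_rem e) ?mem_undup //= multMn mult1 eqxx muln1.
  rewrite big1_seq ?addn0 // => x /andP[_].
  rewrite mem_rem_uniq ?undup_uniq // inE => /andP[xe _].
  by rewrite multMn mult1 eq_sym (negbTE xe) muln0.
rewrite big1_seq // => x /andP[_]; rewrite mem_undup multMn mult1 => xs.
by case: eqP => [ex|]; rewrite ?muln0 //; move: es; rewrite ex xs.
Qed.

Definition msupp a : seq E := finsupp (a : {mset E}%mset).

Lemma mem_msupp a e : (e \in msupp a) = (0 < mult a e)%N.
Proof. by rewrite /msupp msuppE in_mset. Qed.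

Lemma mfunP (s : seq E) (f : E -> nat) : (forall e, (0 < f e)%N -> e \in s) ->
  exists a, mult a =1 f.
Proof.
move=> fs; exists (mfun s f) => e; rewrite mult_fun; case: ifP => //.
by case: (posnP (f e)) => [->|/fs ->].
Qed.

(** Comparison of Cantor normal forms: the largest exponent with different multiplicities
    decides. *)
Definition hess_lt a b :=
  exists2 e, (mult a e < mult b e)%N & forall x, (e < x)%O -> mult a x = mult b x.

Lemma hess_lt_irr a : ~ hess_lt a a.
Proof. by move=> [e]; rewrite ltnn. Qed.

Lemma hess_lt_trans b a c : hess_lt a b -> hess_lt b c -> hess_lt a c.
Proof.
move=> [e ab Eab] [x bc Ebc]; case: (ltgtP e x) => ex.
- exists x => [|y xy]; first by rewrite Eab.
  by rewrite Eab ?Ebc // (lt_trans ex).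
- exists e => [|y ey]; first by rewrite -Ebc.
  by rewrite Eab ?Ebc // (lt_trans ex).
- exists e => [|y ey]; first by rewrite (ltn_trans ab) // ex.
  by rewrite Eab ?Ebc // -ex.
Qed.

Lemma seq_max_sat (P : pred E) s : has P s ->
  exists2 e, e \in s /\ P e & forall x, x \in s -> P x -> (x <= e)%O.
Proof.
elim: s => // e s IH /=; case: (boolP (has P s)) => [/IH[x [xs Px] max_x] _|].
  case: (boolP (P e)) => Pe; last first.
    exists x => [|y]; first by rewrite inE xs orbT.
    by rewrite inE => /predU1P[->|]; [rewrite (negbTE Pe)|exact: max_x].
  case: (leP e x) => ex.
    exists x => [|y]; first by rewrite inE xs orbT.
    by rewrite inE => /predU1P[->|]; last exact: max_x.
  exists e => [|y]; first by rewrite mem_head.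
  rewrite inE => /predU1P[->|ys /(max_x y ys) yx]; first by rewrite lexx.
  exact: le_trans yx (ltW ex).
rewrite orbF => /hasPn sP Pe; exists e => [|y]; first by rewrite mem_head.
by rewrite inE => /predU1P[->|/sP /negbTE ->]; first by rewrite lexx.
Qed.

Lemma hess_lt_total a b : [\/ hess_lt a b, a = b | hess_lt b a].
Proof.
case: (boolP (has (fun e => mult a e != mult b e) (msupp a ++ msupp b))).
  move=> /seq_max_sat[e [_ ab] max_e].
  have agree x : (e < x)%O -> mult a x = mult b x.
    move=> ex; apply/eqP; apply: contraTT ex => abx; rewrite -leNgt; apply: max_e => //.
    rewrite mem_cat !mem_msupp; move: abx; case: (mult a x) => [|//].
    by case: (mult b x).
  by move: ab; rewrite neq_ltn => /orP[ab|ba]; [constructor 1|constructor 3];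
    exists e => // x /agree.
move=> /hasPn H; constructor 2; apply/hessP => e.
have := H e; rewrite mem_cat !mem_msupp negbK.
by case: (mult a e) (mult b e) => [|m] [|n] //= /(_ isT)/eqP.
Qed.

Lemma hess_lt0 a : ~ hess_lt a 0.
Proof. by case=> e; rewrite mult0. Qed.

Lemma hess_ltD2r c a b : hess_lt a b -> hess_lt (a + c) (b + c).
Proof.
by move=> [e ab Eab]; exists e => [|x /Eab]; rewrite !multD ?ltn_add2r // => ->.
Qed.

(** Three nested inductions: on a bound [e] for the exponents, on the multiplicity of [e], and on
    the accessibility of the part with exponents below [e]. *)
Lemma hess_lt_wf : well_founded (fun x y : E => (x < y)%O) -> well_founded hess_lt.
Proof.
move=> wfE.
pose below e a := forall x, (0 < mult a x)%N -> (x < e)%O.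
have acc0 : Acc hess_lt 0 by constructor => b /hess_lt0.
have accE e a : (forall x, (0 < mult a x)%N -> (x <= e)%O) -> Acc hess_lt a.
  elim/(well_founded_ind wfE): e a => e IH.
  have accb a : below e a -> Acc hess_lt a.
    move=> ae; case: (boolP (has predT (msupp a))) => [/seq_max_sat[x [xa _] max_x]|].
      apply: (IH x) => [|y ya]; first by apply: ae; rewrite -mem_msupp.
      by apply: max_x; rewrite ?mem_msupp.
    move=> /hasPn a0; suff -> : a = 0 by [].
    apply/hessP => x; rewrite mult0; apply/eqP; rewrite -leqn0 leqNgt -mem_msupp.
    by apply/negP => /a0.
  (* A predecessor either contains fewer copies of [omega_pow e], or equally many and a smaller
     remainder. *)
  have accn n a : below e a -> Acc hess_lt (omega_pow e *+ n + a).
    elim/ltn_ind: n a => n IHn a ae.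
    have acca := accb a ae; elim: acca ae => {}a _ IHa ae; constructor => b [x bx Ebx].
    have xe : (x <= e)%O.
      rewrite leNgt; apply/negP => ex; move: bx; rewrite multD multMn mult1.
      rewrite (gt_eqF ex) muln0 add0n => bx.
      by have := lt_trans ex (ae x (leq_ltn_trans (leq0n _) bx)); rewrite ltxx.
    have below_b y : (e < y)%O -> mult b y = 0%N.
      move=> ey; rewrite Ebx ?(le_lt_trans xe) // multD multMn mult1 (gt_eqF ey) muln0.
      by apply/eqP; rewrite -leqn0 leqNgt; apply/negP => /ae; rewrite ltNge (ltW ey).
    have [b' Eb'] : exists b', mult b' =1 (fun y => if (y < e)%O then mult b y else 0%N).
      by apply: (mfunP (s := msupp b)) => y; case: ifP => //; rewrite mem_msupp.
    have b'e : below e b' by move=> y; rewrite Eb'; case: ifP.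
    have ae0 : mult a e = 0%N.
      by apply/eqP; rewrite -leqn0 leqNgt; apply/negP => /ae; rewrite ltxx.
    have -> : b = omega_pow e *+ mult b e + b'.
      apply/hessP => y; rewrite multD multMn mult1 Eb'.
      by case: (ltgtP y e) => [_|/below_b ->|->]; rewrite ?muln0 ?muln1 ?addn0.
    have Ee : mult (omega_pow e *+ n + a) e = n by rewrite multD multMn mult1 eqxx ae0 muln1 addn0.
    move: xe; rewrite le_eqVlt => /predU1P[xe|xe].
      by move: bx; rewrite xe Ee => be; apply: IHn.
    have -> : mult b e = n by rewrite (Ebx e xe) Ee.
    apply: (IHa b' _ b'e); exists x => [|y xy].
      by rewrite Eb' xe; move: bx; rewrite multD multMn mult1 (lt_eqF xe) muln0.
    rewrite Eb'; case: (ltgtP y e) => ye.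
    - by rewrite Ebx // multD multMn mult1 (lt_eqF ye) muln0.
    - by apply/esym/eqP; rewrite -leqn0 leqNgt; apply/negP => /ae; rewrite ltNge (ltW ye).
    - by rewrite ye ae0.
  move=> a ae; have [a' Ea'] : exists a', mult a' =1 (fun y => if (y < e)%O then mult a y else 0%N).
    by apply: (mfunP (s := msupp a)) => y; case: ifP => //; rewrite mem_msupp.
  have -> : a = omega_pow e *+ mult a e + a'.
    apply/hessP => y; rewrite multD multMn mult1 Ea'.
    case: (ltgtP y e) => [_|ey|->]; rewrite ?muln0 ?muln1 ?addn0 //.
    by apply/eqP; rewrite -leqn0 leqNgt; apply/negP => /ae; rewrite leNgt ey.
  by apply: accn => y; rewrite Ea'; case: ifP.
move=> a; case: (boolP (has predT (msupp a))) => [/seq_max_sat[x [xa _] max_x]|].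
  by apply: (accE x) => y ya; apply: max_x; rewrite ?mem_msupp.
move=> /hasPn a0; suff -> : a = 0 by [].
apply/hessP => x; rewrite mult0; apply/eqP; rewrite -leqn0 leqNgt -mem_msupp.
by apply/negP => /a0.
Qed.

Lemma hess_value_order : well_founded (fun x y : E => (x < y)%O) -> value_order hess_lt.
Proof.
move=> wfE; split; [exact: hess_lt_irr|exact: hess_lt_trans|exact: hess_lt_total| | |].
- exact: hess_lt_wf.
- exact: hess_lt0.
- exact: hess_ltD2r.
Qed.

Lemma hess_min_split a : a != 0 -> exists e a', a = a' + omega_pow e /\
  forall x, (0 < mult a x)%N -> (e <= x)%O.
Proof.
move=> a0; have : has predT (msupp a).
  apply: contraNT a0 => /hasPn H; apply/eqP/hessP => x; rewrite mult0; apply/eqP.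
  by rewrite -leqn0 leqNgt -mem_msupp; apply/negP => /H.
move=> supp_a; have [e ea min_e] : exists2 e, e \in msupp a &
    forall x, x \in msupp a -> (e <= x)%O.
  elim: (msupp a) supp_a => // e s IH _; case: (boolP (has predT s)) => [/IH[x xs min_x]|].
    exists (Order.min e x); first by rewrite inE; case: leP => //; rewrite ?eqxx ?xs ?orbT.
    by move=> y; rewrite inE ge_min => /predU1P[->|/min_x ->]; rewrite ?lexx ?orbT.
  case: s {IH} => // _; exists e; first exact: mem_head.
  by move=> x; rewrite inE => /eqP ->.
have [a' Ea'] : exists a', mult a' =1 (fun y => (mult a y - (y == e))%N).
  apply: (mfunP (s := msupp a)) => y; rewrite mem_msupp subn_gt0.
  exact: leq_ltn_trans.
exists e, a'; split; last by move=> x; rewrite -mem_msupp; exact: min_e.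
apply/hessP => y; rewrite multD mult1 Ea' subnK //.
by case: eqP => // ->; rewrite -mem_msupp.
Qed.

Section MinExponent.
Variables (e : E) (a' : hessenberg).
Let a := a' + omega_pow e.
Hypothesis ea : forall x, (0 < mult a x)%N -> (e <= x)%O.

Lemma hess_lt_min : hess_lt a' a.
Proof.
exists e => [|x ex]; rewrite multD mult1 ?eqxx ?addn1 //.
by rewrite (gt_eqF ex) addn0.
Qed.

(** The right side loses a single copy of the smallest exponent, the left side loses in both
    summands. If the larger of the two places of loss is above [e], it decides; otherwise both are
    [e] and the left side loses at least two copies. *)
Lemma hess_ltD_min b s t : (forall x, (0 < mult b x)%N -> (e <= x)%O) ->
  hess_lt s a -> hess_lt t b -> hess_lt (s + t) (a' + b).
Proof.
move=> eb [x sx Ex] [y ty Ey].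
have ex : (e <= x)%O by apply/ea/(leq_ltn_trans _ sx).
have ey : (e <= y)%O by apply/eb/(leq_ltn_trans _ ty).
have multa w : mult a w = (mult a' w + (w == e))%N by rewrite multD mult1.
case: (leP x y) => xy.
  exists y => [|w yw]; rewrite !multD.
    case: (ltgtP x y) xy => // xy _.
      have ye : (y == e) = false by rewrite gt_eqF // (le_lt_trans ex xy).
      by have := Ex _ xy; rewrite multa ye addn0 => ->; rewrite ltn_add2l.
    by rewrite xy multa in sx; move: sx ty; case: (y == e); rewrite ?addn1 ?addn0; lia.
  have we : (w == e) = false by rewrite gt_eqF // (le_lt_trans ey yw).
  by rewrite (Ey _ yw) (Ex _ (le_lt_trans xy yw)) multa we addn0.
exists x => [|w xw]; rewrite !multD.
  have xe : (x == e) = false by rewrite gt_eqF // (le_lt_trans ey xy).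
  by move: sx; rewrite multa xe addn0 (Ey _ xy) ltn_add2r.
have we : (w == e) = false by rewrite gt_eqF // (le_lt_trans ex xw).
by rewrite (Ex _ xw) (Ey _ (lt_trans xy xw)) multa we addn0.
Qed.

Lemma hess_ltD_min_strict b t : (forall x, (0 < mult b x)%N -> (e < x)%O) ->
  hess_lt t b -> hess_lt (t + a) (a' + b).
Proof.
move=> eb [y ty Ey]; have ey : (e < y)%O by apply/eb/(leq_ltn_trans _ ty).
exists y => [|w yw]; rewrite !multD mult1.
  by rewrite (gt_eqF ey) addn0 addnC ltn_add2l.
by rewrite (gt_eqF (lt_trans ey yw)) addn0 addnC (Ey _ yw).
Qed.

(** As [e] is the least exponent, an element between [a' + b] and [a + b] is [a' + b + r] with all
    exponents of [r] below [e]; then [u] is [a' + r]. *)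
Lemma hess_cofinal b g : (forall x, (0 < mult b x)%N -> (e <= x)%O) ->
  hess_lt g (a + b) -> exists2 u, hess_lt u a /\ ~ hess_lt u a' & ~ hess_lt (u + b) g.
Proof.
move=> eb [x gx Ex]; have [lt_g|ge_g] := pselect (hess_lt g (a' + b)).
  exists a' => [|lt_g']; last exact: hess_lt_irr (hess_lt_trans lt_g' lt_g).
  by split; [exact: hess_lt_min|exact: hess_lt_irr].
have multa w : mult a w = (mult a' w + (w == e))%N by rewrite multD mult1.
have ex : (e <= x)%O.
  have : (0 < mult (a + b)%R x)%N by apply: leq_ltn_trans gx.
  by rewrite multD addn_gt0 => /orP[/ea|/eb].
have xe : x = e.
  apply: contra_notP ge_g => /eqP xNe; have {}ex : (e < x)%O by rewrite lt_neqAle eq_sym xNe.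
  exists x => [|w xw]; first by move: gx; rewrite !multD mult1 (negbTE xNe) addn0.
  by rewrite (Ex _ xw) !multD mult1 (gt_eqF (lt_trans ex xw)) addn0.
subst x; have ge : mult g e = mult (a' + b) e.
  apply/eqP; rewrite eqn_leq; apply/andP; split.
    by move: gx; rewrite !multD mult1 eqxx; lia.
  rewrite leqNgt; apply: contra_notN ge_g => ge; exists e => // w ew.
  by rewrite (Ex _ ew) !multD mult1 (gt_eqF ew) addn0.
have low w : (w < e)%O -> mult a' w = 0%N /\ mult b w = 0%N.
  move=> we; split; apply/eqP; rewrite -leqn0 leqNgt.
    by apply/negP => aw; have := @ea w; rewrite multa addn_gt0 aw leNgt we => /(_ isT).
  by apply/negP => /eb; rewrite leNgt we.
have [r Er] : exists r, mult r =1 (fun y => if (y < e)%O then mult g y else 0%N).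
  by apply: (mfunP (s := msupp g)) => y; case: ifP => //; rewrite mem_msupp.
exists (a' + r).
  split.
    exists e => [|w ew]; rewrite !multD mult1 Er.
      by rewrite ltxx eqxx addn0 addn1.
    by rewrite (gt_eqF ew) ltNge (ltW ew).
  by case=> w; rewrite multD ltnNge leq_addr.
suff -> : a' + r + b = g by exact: hess_lt_irr.
apply/hessP => w; rewrite addrAC multD Er; case: (ltgtP w e) => we.
- by have [aw bw] := low _ we; rewrite multD aw bw.
- by rewrite addn0 (Ex _ we) !multD mult1 (gt_eqF we) addn0.
- by rewrite addn0 we ge.
Qed.

End MinExponent.
End Hessenberg.

Definition natlt (a b : nat) : Prop := (a < b)%N.

Lemma nat_value_order : value_order natlt.
Proof.
rewrite /natlt; split.
- by move=> a; rewrite ltnn.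
- by move=> b a c; exact: ltn_trans.
- by move=> a b; case: (ltngtP a b) => ab; [constructor 1|constructor 3|constructor 2].
- by move=> n; elim/ltn_ind: n => n IH; constructor.
- by move=> a; rewrite ltn0.
- by move=> c a b; rewrite -[a + c]/(a + c)%N -[b + c]/(b + c)%N ltn_add2r.
Qed.

(** * Germ shifts as derivations *)

Section Leibniz.
Variables (R : realType) (K : fieldType).
Local Notation H := (hahn R K).
Variables (G : nmodType) (lt : G -> G -> Prop) (ltG : value_order lt).
Implicit Types (c d : H) (z : R) (u v w : G).

Lemma rank_lt_mull u v c d : rank_lt lt c u 0 -> rank_le lt d v 0 ->
  rank_lt lt (c * d) (u + v) 0.
Proof.
move=> [c0|[u' u'u cu']] dv; first by left; apply: germ0_mull.
by right; exists (u' + v); [exact: vltD2r|exact: rank_le_mul].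
Qed.

Lemma rank_lt_mulr u v c d : rank_le lt c u 0 -> rank_lt lt d v 0 ->
  rank_lt lt (c * d) (u + v) 0.
Proof. by move=> cu dv; rewrite mulrC addrC; apply: rank_lt_mull. Qed.

Lemma rank_lt_weak (f : R -> K) u v x : ~ lt v u -> rank_lt lt f u x -> rank_lt lt f v x.
Proof.
move=> uv; have [vu|<-//|uv'] := vlt_total ltG v u; first by case: uv.
exact: rank_lt_mono.
Qed.

Lemma rank_le_weak (f : R -> K) u v x : ~ lt v u -> rank_le lt f u x -> rank_le lt f v x.
Proof.
move=> uv; have [vu|<-//|uv'] := vlt_total ltG v u; first by case: uv.
exact: rank_le_mono.
Qed.

Lemma hrank_le1 : rank_le lt (1 : H) 0 0.
Proof.
apply/rank_leP; exists (-1) => [|y /andP[ey y0]]; first lra.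
left; exists (-1) => // t /andP[_ ty].
rewrite /= /one_coef; case: eqP => // t0; exfalso; lra.
Qed.

Lemma rank_le_exp u c n : rank_le lt c u 0 -> rank_le lt (c ^+ n) (u *+ n) 0.
Proof.
move=> cu; elim: n => [|n IH]; first by rewrite expr0 mulr0n; exact: hrank_le1.
by rewrite exprS mulrS; apply: rank_le_mul.
Qed.

(* Modulo the contribution of interior pairs, [hshift z] acts as a derivation. *)
Lemma leibniz u v w c d : rank_le lt c u 0 -> rank_le lt d v 0 ->
  (forall s t, lt s u -> lt t v -> lt (s + t) w) ->
  exists2 e, e < 0 & forall z, e < z < 0 ->
    rank_lt lt (hshift z (c * d) - (hshift z c * d + c * hshift z d)) w 0.
Proof.
move=> cu dv stw.
have /rank_leP[e e0 ce] := cu; have /rank_leP[e' e'0 de] := dv.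
exists (Num.max e e'); first by rewrite gt_max e0.
move=> z; rewrite gt_max => /andP[/andP[ez e'z] z0].
have := @mul_local _ _ _ _ ltG w [:: z; 0] c d z.
rewrite !big_cons big_nil addr0 subrr subr0 !hshift0; apply.
  by rewrite /= inE (lt_eqF z0).
move=> x; rewrite !inE negb_or => /andP[/eqP xz /eqP x0].
have [{}x0|x0'] := ltP 0 x.
  by left; apply/germ0_mull/germ0_hshift/germ0_gt0.
have [{}xz|zx'] := ltP x z.
  by left; apply/germ0_mulr/germ0_hshift/germ0_gt0; rewrite subr_gt0.
have {x0 x0'} x0 : x < 0 by rewrite lt_neqAle x0' andbT; apply/eqP.
have {xz zx'} zx : z < x by rewrite lt_neqAle zx' andbT eq_sym; apply/eqP.
have [c0|[s su cs]] : rank_lt lt (hshift x c) u 0.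
- by apply/(rank_lt_hshift ltG)/ce; lra.
- by left; apply: germ0_mull.
have [d0|[t tv dt]] : rank_lt lt (hshift (z - x) d) v 0.
- by apply/(rank_lt_hshift ltG)/de; lra.
- by left; apply: germ0_mulr.
by right; exists (s + t); [exact: stw|exact: rank_le_mul].
Qed.

Lemma rank_le_left c u : rank_le lt c u 0 ->
  exists2 e, e < 0 & forall z, e < z < 0 -> rank_lt lt (hshift z c) u 0.
Proof. by move=> /rank_leP[e e0 ce]; exists e => // z /ce /(rank_lt_hshift ltG). Qed.

Lemma rank_eq_hshift c u w z : rank_lt lt (hshift z c) u 0 -> ~ rank_lt lt c w z ->
  exists v, [/\ rank_eq lt (hshift z c) v 0, lt v u & ~ lt v w].
Proof.
move=> [c0|[u' u'u cu']] cw.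
  by exfalso; apply/cw/(rank_lt_hshift ltG); left.
have [|v uv cv] := rank_eq_exists ltG cu'.
  by move=> c0; apply/cw/(rank_lt_hshift ltG); left.
exists v; split => //.
  by have [vu'|->//|/uv//] := vlt_total ltG v u'; exact: (vlt_trans ltG vu' u'u).
by move=> vw; apply/cw/(rank_lt_hshift ltG); right; exists v => //; case: cv.
Qed.

Lemma rank_lt_lt c u v x : lt v u -> rank_lt lt c u x -> exists2 w, lt w u & rank_le lt c w x.
Proof. by move=> vu [c0|[w wu cw]]; [exists v => //; apply: germ0_rank_le|exists w]. Qed.

Lemma coef_mulrn c n x : (c *+ n) x = c x *+ n.
Proof. by elim: n => [|n IH]; rewrite ?mulr0n ?mulrS // Defs.coefD IH. Qed.

(** This division is where characteristic 0 enters the additivity of ranks. *)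
Lemma hrank_lt_mulrn c n u x : [pchar K] =i pred0 ->
  rank_lt lt (c *+ n.+1) u x -> rank_lt lt c u x.
Proof.
move=> /pcharf0P charK /(hrank_ltZ ltG (n.+1%:R^-1)).
suff -> : const (n.+1%:R^-1) * (c *+ n.+1) = c by [].
apply/hahnP => y; rewrite coef_const_mul coef_mulrn -[c y *+ _]mulr_natl mulrA mulVf ?mul1r //.
by rewrite charK.
Qed.

End Leibniz.

(** * Multiplicativity of the rank *)

Section Multiplicativity.
Variables (R : realType) (K : fieldType) (charK : [pchar K] =i pred0).
Variables (disp : Order.disp_t) (E : orderType disp).
Hypothesis wfE : well_founded (fun x y : E => (x < y)%O).
Local Notation H := (hahn R K).
Local Notation lt := (@hess_lt disp E).
Let ltG := hess_value_order wfE.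
Implicit Types (c d : H) (z : R) (a b : hessenberg E).

(** The rule D(c d^(k+1)) = (k+1) c d^k D(d): the term with D(c) is negligible because every
    exponent of [a] exceeds [e], so lowering [a] costs more than the copy of [omega_pow e] missing
    from [b']. *)
Lemma hshift_mul_exp e b' a c d k (b := b' + omega_pow e) :
  (forall x, (0 < mult b x)%N -> (e <= x)%O) ->
  (forall x, (0 < mult a x)%N -> (e < x)%O) ->
  rank_le lt c a 0 -> rank_le lt d b 0 ->
  exists2 r, r < 0 & forall z, r < z < 0 ->
    rank_lt lt (hshift z (c * d ^+ k.+1) - (c * d ^+ k * hshift z d) *+ k.+1)
      (b' + (a + b *+ k)) 0.
Proof.
move=> eb ea ca db.
have ea_ x : (0 < mult a x)%N -> (e <= x)%O by move=> /ea/ltW.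
elim: k => [|k [r r0 IH]].
  have [|r r0 lr] := @leibniz _ _ _ _ ltG _ _ (b' + a) c d ca db.
    by move=> s t sa tb; rewrite addrC; exact: (@hess_ltD_min _ _ e).
  have [r' r'0 cr'] := rank_le_left ltG ca.
  exists (Num.max r r'); first by rewrite gt_max r0.
  move=> z; rewrite gt_max => /andP[/andP[rz r'z] z0].
  rewrite expr1 expr0 mulr1 mulr1n mulr0n addr0.
  have -> : hshift z (c * d) - c * hshift z d =
      (hshift z (c * d) - (hshift z c * d + c * hshift z d)) + hshift z c * d.
    by rewrite opprD addrA addrAC addrNK.
  apply: (hrank_ltD ltG); first by apply: lr; rewrite rz.
  have [c0|[s sa cs]] : rank_lt lt (hshift z c) a 0 by apply: cr'; rewrite r'z.
    by left; apply: germ0_mull.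
  by right; exists (s + b); [exact: (@hess_ltD_min_strict _ _ e)|exact: rank_le_mul].
have cdk : rank_le lt (c * d ^+ k.+1) (a + b *+ k.+1) 0.
  by apply: rank_le_mul => //; apply: rank_le_exp.
have [|r' r'0 lr] := @leibniz _ _ _ _ ltG _ _ (b' + (a + b *+ k.+1)) _ d cdk db.
  move=> s t sa tb; rewrite addrC; apply: (@hess_ltD_min _ _ e) => // x.
  by rewrite multD multMn addn_gt0 muln_gt0 => /orP[/ea_//|/andP[_ /eb]].
exists (Num.max r r'); first by rewrite gt_max r0.
move=> z; rewrite gt_max => /andP[/andP[rz r'z] z0].
have {}IH := IH z; rewrite rz z0 in IH; have {}IH := IH isT.
have {}lr := lr z; rewrite r'z z0 in lr; have {}lr := lr isT.
have {IH} := rank_lt_mull ltG IH db.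
have -> : b' + (a + b *+ k) + b = b' + (a + b *+ k.+1) by rewrite mulrSr !addrA.
move=> /(hrank_ltD ltG lr); congr (rank_lt _ (coef _) _ _).
rewrite [d ^+ k.+2]exprSr [c * (_ * d)]mulrA mulrBl mulrnAl.
have -> : c * d ^+ k * hshift z d * d = c * d ^+ k.+1 * hshift z d.
  by rewrite exprSr mulrAC !mulrA.
by rewrite [_ *+ k.+2]mulrS !opprD -!addrA; congr (_ + _); rewrite addrCA addKr.
Qed.

Lemma rank_eq0_coef c : rank_eq lt c 0 0 -> c 0 != 0.
Proof.
move=> [/rank_leP[r r0 cr] c0]; apply: contra_notN c0 => /eqP c00; left.
exists r => // y /andP[ry]; rewrite le_eqVlt => /predU1P[-> //|y0].
have [|[t ty ct]|[v /hess_lt0]//] := cr y; first by rewrite ry.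
by apply: ct; rewrite ty lexx.
Qed.

(** Induction on [b], then on [a]. If the smallest exponent occurs in [a], the rank of [c] is
    lowered and the power of [d] doubled; otherwise [c * d ^+ k] becomes the first factor and the
    rank of [d] is lowered. *)
Lemma rank_mul_exp_ge b a c d k : rank_eq lt c a 0 -> rank_eq lt d b 0 ->
  ~ rank_lt lt (c * d ^+ k) (a + b *+ k) 0.
Proof.
elim/(well_founded_ind (vlt_wf ltG)): b a c d k => b IHb a.
elim/(well_founded_ind (vlt_wf ltG)): a => a IHa c d.
have [[-> ->] k c0 d0|nab] := pselect (a = 0 /\ b = 0).
  rewrite mul0rn addr0 => -[[r r0 cd]|[v /hess_lt0//]].
  have := cd 0; rewrite r0 lexx coefM0 => /(_ isT)/eqP; apply/negP.
  have -> : (d ^+ k) 0 = d 0 ^+ k.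
    by elim: k {cd} => [|k IH]; rewrite ?expr0 ?exprS ?coefM0 ?IH //= /one_coef eqxx.
  by rewrite mulf_neq0 ?expf_neq0 ?rank_eq0_coef.
have [[e [a' [Ea ea eb]]]|case2] := pselect (exists e a', [/\ a = a' + omega_pow e,
   forall x, (0 < mult a x)%N -> (e <= x)%O & forall x, (0 < mult b x)%N -> (e <= x)%O]).
  (* If [c * D] is degenerate, so is [hshift z c * D + c * hshift z D]; times [D],
     its second term [(c * D) * hshift z D] is negligible, hence the product of
     [hshift z c], of smaller rank than [c], with a power of [d] is degenerate. *)
  move=> k [ca nca] [db ndb]; set B := b *+ k; set D := d ^+ k => cd.
  have eB x : (0 < mult B x)%N -> (e <= x)%O.
    by rewrite multMn muln_gt0 => /andP[_ /eb].
  have DB : rank_le lt D B 0 by apply: rank_le_exp.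
  have a'a : lt a' a by rewrite Ea; apply: hess_lt_min.
  have [g gw cdg] := rank_lt_lt (vltD2r ltG B a'a) cd.
  (* [u] is large enough for [c * D] to have rank at most [u + B], yet below the rank of [c]. So
     germs of [c] of rank at least [u] occur arbitrarily close to 0, where those of [c * D] have
     rank below [u + B]. As [u] is at least [a'], the Leibniz error is negligible too. *)
  have [u [ua ua'] ug] : exists2 u, lt u a /\ ~ lt u a' & ~ lt (u + B) g.
    by rewrite Ea in ea gw *; apply: (hess_cofinal ea eB gw).
  have cdu : rank_le lt (c * D) (u + B) 0 := rank_le_weak ltG ug cdg.
  have [r1 r10 R1] := rank_le_left ltG ca.
  have [r2 r20 R2] := rank_le_left ltG DB.
  have [r3 r30 R3] := rank_le_left ltG cdu.
  have [|r4 r40 R4] := @leibniz _ _ _ _ ltG _ _ (a' + B) _ _ ca DB.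
    by move=> s t sa tB; apply: (@hess_ltD_min _ _ e); rewrite -?Ea.
  have ncu : ~ rank_le lt c u 0 by move=> cu; apply: nca; right; exists u.
  have [|z] := rank_gt_left ncu (e := Num.max (Num.max r1 r2) (Num.max r3 r4)).
    by rewrite !gt_max r10 r20 r30.
  rewrite !gt_max -!andbA => /and5P[r1z r2z r3z r4z z0] cuz.
  have {}R1 := R1 z; rewrite r1z z0 in R1; have {}R1 := R1 isT.
  have {}R2 := R2 z; rewrite r2z z0 in R2; have {}R2 := R2 isT.
  have {}R3 := R3 z; rewrite r3z z0 in R3; have {}R3 := R3 isT.
  have {}R4 := R4 z; rewrite r4z z0 in R4; have {}R4 := R4 isT.
  have {}R4 : rank_lt lt (hshift z (c * D) - (hshift z c * D + c * hshift z D)) (u + B) 0.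
    apply: (rank_lt_weak ltG _ R4).
    have [ua''|->|a'u] := vlt_total ltG u a'; first by case: ua'.
    - exact: vlt_irr ltG _.
    - by move=> uB; apply: (vlt_irr ltG) (vlt_trans ltG uB (vltD2r ltG B a'u)).
  have small : rank_lt lt (hshift z c * D * D) (u + B + B) 0.
    have -> : hshift z c * D * D = (hshift z (c * D) -
       (hshift z (c * D) - (hshift z c * D + c * hshift z D))) * D - c * D * hshift z D.
      by rewrite subKr mulrDl [c * _ * D]mulrAC addrK.
    apply: (hrank_ltB ltG).
      exact/(rank_lt_mull ltG _ DB)/(hrank_ltB ltG R3 R4).
    exact: (rank_lt_mulr ltG).
  have [v [zv va vu]] := rank_eq_hshift ltG R1 cuz.
  have db' : rank_eq lt d b 0 by [].
  apply: (IHa _ va _ _ (k + k)%N zv db').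
  rewrite exprD mulrA mulrnDr addrA; apply: (rank_lt_weak ltG _ small).
  have [//|->|uv] := vlt_total ltG v u; first exact: vlt_irr ltG _.
  move=> vB; apply: (vlt_irr ltG) (vlt_trans ltG vB _).
  by do 2 apply: (vltD2r ltG).
have [b0|b0] := eqVneq b 0.
  have [a0|/hess_min_split[e [a' [Ea ea]]]] := eqVneq a 0; first by case: nab.
  by case: case2; exists e, a'; split => // x; rewrite b0 mult0.
(* Otherwise [hshift z (c * d ^+ k.+1)] is [k.+1] times [c * d ^+ k * hshift z d],
   up to smaller rank, and [hshift z d] has smaller rank than [d]. *)
have [f [b' [Eb fb]]] := hess_min_split b0.
have fa x : (0 < mult a x)%N -> (f < x)%O.
  have [a0|/hess_min_split[e [a' [Ea ea]]]] := eqVneq a 0.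
    by rewrite a0 mult0.
  move=> /ea; apply: lt_le_trans; rewrite ltNge; apply/negP => ef; apply: case2.
  by exists e, a'; split => // y /fb; apply: le_trans.
move=> k ca db; elim: k => [|k IHk]; first by rewrite mulr1 mulr0n addr0; case: ca.
have [[ca' _] [db' ndb]] := (ca, db).
have fD x : (0 < mult (a + b *+ k)%R x)%N -> (f <= x)%O.
  by rewrite multD multMn addn_gt0 muln_gt0 => /orP[/fa/ltW|/andP[_ /fb]].
have b'b : lt b' b by rewrite Eb; apply: hess_lt_min.
set D := a + b *+ k in IHk fD; rewrite mulrS addrCA -/D => cd.
have cdk : rank_le lt (c * d ^+ k) D 0.
  by apply: (rank_le_mul ltG) => //; apply: (rank_le_exp ltG).
have [g gw cdg] := rank_lt_lt (vltD2r ltG D b'b) cd.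
have [u [ub ub'] ug] : exists2 u, lt u b /\ ~ lt u b' & ~ lt (u + D) g.
  by rewrite Eb in fb gw *; apply: (hess_cofinal fb fD gw).
have cdu : rank_le lt (c * d ^+ k.+1) (u + D) 0 := rank_le_weak ltG ug cdg.
have [r1 r10 R1] := rank_le_left ltG db'.
have [r3 r30 R3] := rank_le_left ltG cdu.
have fb' := fb; have db'' := db'; rewrite Eb in fb' db''.
have := @hshift_mul_exp f b' a c d k fb' fa ca' db''; rewrite -Eb => -[r4 r40 R4].
have ndu : ~ rank_le lt d u 0 by move=> du; apply: ndb; right; exists u.
have [|z] := rank_gt_left ndu (e := Num.max r1 (Num.max r3 r4)).
  by rewrite !gt_max r10 r30.
rewrite !gt_max -!andbA => /and4P[r1z r3z r4z z0] duz.
have {}R1 := R1 z; rewrite r1z z0 in R1; have {}R1 := R1 isT.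
have {}R3 := R3 z; rewrite r3z z0 in R3; have {}R3 := R3 isT.
have {}R4 := R4 z; rewrite r4z z0 in R4; have {}R4 := R4 isT.
have {}R4 : rank_lt lt (hshift z (c * d ^+ k.+1) - (c * d ^+ k * hshift z d) *+ k.+1)
    (u + D) 0.
  apply: (rank_lt_weak ltG _ R4).
  have [ub''|->|b'u] := vlt_total ltG u b'; first by case: ub'.
  - exact: vlt_irr ltG _.
  - by move=> uD; apply: (vlt_irr ltG) (vlt_trans ltG uD (vltD2r ltG D b'u)).
have small : rank_lt lt (c * d ^+ k * hshift z d) (u + D) 0.
  apply: (hrank_lt_mulrn ltG charK (n := k)).
  by have := hrank_ltB ltG R3 R4; rewrite subKr.
have [v [zv vb vu]] := rank_eq_hshift ltG R1 duz.
have cdk' : rank_eq lt (c * d ^+ k) D 0 by [].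
apply: (IHb _ vb _ _ _ 1%N cdk' zv); rewrite expr1 mulr1n addrC.
apply: (rank_lt_weak ltG _ small).
have [//|->|uv] := vlt_total ltG v u; first exact: vlt_irr ltG _.
by move=> vD; apply: (vlt_irr ltG) (vlt_trans ltG vD (vltD2r ltG D uv)).
Qed.

Theorem rank_mul a b c d : rank_eq lt c a 0 -> rank_eq lt d b 0 ->
  rank_eq lt (c * d) (a + b) 0.
Proof.
move=> ca db; split; first by case: ca db => [ca _] [db _]; apply: (rank_le_mul ltG).
by have := @rank_mul_exp_ge b a c d 1 ca db; rewrite expr1.
Qed.

End Multiplicativity.

(** * Ranks of the factors *)

Section WellOrderedSubtype.
Variables (R : realType) (A : set R).

Definition wo_sub := {x : R | x \in A}.
HB.instance Definition _ := SubChoice.on wo_sub.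
HB.instance Definition _ := [SubChoice_isSubOrder of wo_sub by <: with ring_display].

Lemma wo_sub_wf : well_ordered A -> well_founded (fun x y : wo_sub => (x < y)%O).
Proof.
move=> /well_orderedP woA x; apply: contrapT => Nx.
pose B := [set val y | y in [set y : wo_sub | ~ Acc (fun x y : wo_sub => (x < y)%O) y]].
have [||_ [y Ny <-] lbm] := woA B.
- by move=> _ [y _ <-]; exact: set_mem (valP y).
- by exists (val x), x.
apply: Ny; constructor => z zy; apply: contrapT => Nz.
have : val y <= val z by apply: lbm; exists z.
by rewrite leNgt; move: zy; rewrite ltEsub => ->.
Qed.

End WellOrderedSubtype.

(** * Points of maximal rank *)

Section MaximalRank.
Variables (R : realType) (K : fieldType).
Local Notation H := (hahn R K).
Implicit Types (c d : H) (x y z : R).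

Lemma nongerm0_le0 c x : ~ germ0 c x -> x <= 0.
Proof. by move=> cx; rewrite leNgt; apply/negP => /germ0_gt0. Qed.

Lemma right_germ0 c x : exists2 e, x < e & forall y, x < y < e -> germ0 c y.
Proof.
have [e xe c0] := hahn_right_zero c x; exists e => // y /andP[xy ye].
by exists x => // t /andP[xt ty]; apply: c0; rewrite xt (le_lt_trans ty).
Qed.

Lemma supp_lower_bound c : exists m, forall x, x <= m -> c x = 0.
Proof.
have /well_orderedP wo := @hahn_wo R K c.
have [c0|] := pselect (supp c !=set0); last first.
  move=> c0; exists 0 => x _; apply/eqP; apply: contra_notT c0 => cx.
  by exists x.
have [m cm lbm] := wo _ (@subset_refl _ _) c0.
exists (m - 1) => x xm; apply/eqP; apply: contraLR xm => cx; rewrite -ltNge.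
by have := lbm x cx; lra.
Qed.

(** If an infimum were not attained, points with nonzero germ would approach it from the right,
    where all germs vanish. *)
Lemma nongerm0_wo c : well_ordered [set x | ~ germ0 c x].
Proof.
apply/well_orderedP => B Bc [x0 Bx0].
have [m cm] := supp_lower_bound c.
have lbm : lbound B m.
  move=> x /Bc cx; rewrite leNgt; apply/negP => /ltW xm; apply: cx.
  by exists (x - 1) => [|t /andP[_ tx]]; [rewrite gtrBl|apply/cm/(le_trans tx)].
have infB : has_inf B by split; [exists x0|exists m].
have [BI|BI] := pselect (B (inf B)).
  by exists (inf B) => // x Bx; apply: ge_inf => //; case: infB.
have [e ie c0] := right_germ0 c (inf B).
have [|x Bx xe] := inf_adherent (_ : 0 < e - inf B) infB; first by rewrite subr_gt0.
exfalso; apply: (Bc _ Bx); apply: c0; rewrite subrKC in xe; rewrite xe andbT.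
rewrite lt_neqAle ge_inf ?andbT //; last by case: infB.
by apply/eqP => ix; apply: BI; rewrite ix.
Qed.

Variables (G : nmodType) (lt : G -> G -> Prop) (ltG : value_order lt).
Implicit Types a b : G.

(** Take the least bound [a] of all ranks. If no point attained it, ranks would be locally bounded
    below [a], hence by compactness bounded below [a] everywhere. The first point attaining it
    exists by [nongerm0_wo]. *)
Lemma max_rank c x0 a0 : ~ germ0 c x0 -> (forall x, rank_le lt c a0 x) ->
  exists a x, [/\ rank_eq lt c a x, forall y, rank_le lt c a y &
    forall y, y < x -> rank_lt lt c a y].
Proof.
move=> cx0 ca0.
have [a [ca min_a]] : exists a, (forall x, rank_le lt c a x) /\
    forall b, lt b a -> ~ (forall x, rank_le lt c b x).
  elim/(well_founded_ind (vlt_wf ltG)): a0 ca0 => a IH ca.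
  have [[b [ba cb]]|nb] := pselect (exists b, lt b a /\ forall x, rank_le lt c b x).
    exact: IH cb.
  by exists a; split => // b ba cb; apply: nb; exists b.
have [x1 cx1] : exists x, ~ rank_lt lt c a x.
  apply: contrapT => nx.
  have cx x : rank_lt lt c a x by apply: contrapT => cx; apply: nx; exists x.
  have [//|[b0 b0a _]] := cx x0.
  have [m cm] := supp_lower_bound c.
  (* The interval contains every point with a nonzero germ: coefficients vanish up to [m], and
     exponents above 0 do not occur. *)
  have [b ba cb] : exists2 b, lt b a & forall x, Num.min m 0 - 1 < x <= 1 -> rank_le lt c b x.
    apply: (real_induction (Q := fun u v => exists2 b, lt b a &
        forall x, u < x <= v -> rank_le lt c b x)).
    - by have : Num.min m 0 <= 0; [rewrite ge_min lexx orbT|lra].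
    - move=> x y z _ xy yz _ [b1 b1a c1] [b2 b2a c2].
      have [b12|b12|b21] := vlt_total ltG b1 b2.
      + exists b2 => // t /andP[xt tz]; have [ty|yt] := leP t y.
          by apply: (rank_le_mono ltG b12); apply: c1; rewrite xt.
        by apply: c2; rewrite yt.
      + exists b2 => // t /andP[xt tz]; have [ty|yt] := leP t y.
          by rewrite -b12; apply: c1; rewrite xt.
        by apply: c2; rewrite yt.
      + exists b1 => // t /andP[xt tz]; have [ty|yt] := leP t y.
          by apply: c1; rewrite xt.
        by apply: (rank_le_mono ltG b21); apply: c2; rewrite yt.
    - move=> x _; have [c0|[b ba /[dup] cb /rank_leP[e ex ce]]] := cx x.
        have [e ex ce] := germ0_left c0; exists e => // y /andP[ey yx].
        exists b0 => // t /andP[yt]; rewrite le_eqVlt => /predU1P[->|tx].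
          exact: germ0_rank_le.
        by apply/germ0_rank_le/ce; rewrite tx (lt_trans ey).
      exists e => // y /andP[ey yx]; exists b => // t /andP[yt].
      rewrite le_eqVlt => /predU1P[-> //|tx].
      by apply: (rank_lt_le ltG); apply: ce; rewrite tx (lt_trans ey).
    - move=> x _; have [e xe ce] := right_germ0 c x; exists e => // y /andP[xy ye].
      exists b0 => // t /andP[xt ty]; apply/germ0_rank_le/ce.
      by rewrite xt (le_lt_trans ty).
  apply: (min_a b ba) => x; have [x1|x1] := leP x 1; last first.
    by apply/germ0_rank_le/germ0_gt0; lra.
  have [mx|xm] := ltP (Num.min m 0 - 1) x; first by apply: cb; rewrite mx.
  apply: germ0_rank_le; exists (x - 1) => [|t /andP[_ tx]]; first by rewrite gtrBl.
  apply: cm; have : Num.min m 0 <= m by rewrite ge_min lexx.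
  lra.
have /well_orderedP wo := @nongerm0_wo c.
have [||x cx lbx] := wo [set x | ~ rank_lt lt c a x].
- by move=> x cx c0; apply: cx; left.
- by exists x1.
exists a, x; split => // y yx; apply: contrapT => cy.
by have := lbx y cy; rewrite leNgt yx.
Qed.

End MaximalRank.

Section Factors.
Variables (R : realType) (K : fieldType) (charK : [pchar K] =i pred0).
Local Notation H := (hahn R K).
Implicit Types (c d : H) (x y z : R).

Section RankValues.
Variables (A : set R) (woA : well_ordered A).
Local Notation E := (wo_sub A).
Local Notation hlt := (@hess_lt _ E).
Let hltG := hess_value_order (wo_sub_wf woA).
Hypotheses (A0 : A 0) (A_le0 : forall x, A x -> x <= 0).

Lemma omega_pow_lt (e f : E) : (e < f)%O -> hlt (omega_pow e) (omega_pow f).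
Proof.
move=> ef; exists f => [|u fu]; rewrite !mult1 ?eqxx ?(gt_eqF ef) ?(gt_eqF fu) //.
by rewrite (gt_eqF (lt_trans ef fu)).
Qed.

(** A crude bound whose only purpose is to provide values: the points of nonzero germ to the left of
    [e] are smaller exponents. *)
Lemma rank_le_omega_pow c (e : E) : [set x | ~ germ0 c x] `<=` A ->
  rank_le hlt c (omega_pow e) (val e).
Proof.
move=> cA; elim/(well_founded_ind (wo_sub_wf woA)): e => e IH.
apply/rank_leP; exists (val e - 1) => [|y /andP[_ ye]]; first by rewrite gtrBl.
have [c0|cy] := pselect (germ0 c y); first by left.
pose f : E := Sub y (mem_set (cA _ cy)).
have fe : (f < e)%O by rewrite ltEsub.
by right; exists (omega_pow f); [exact: omega_pow_lt|exact: IH].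
Qed.

Lemma rank_le_top c : [set x | ~ germ0 c x] `<=` A ->
  forall x, rank_le hlt c (omega_pow (Sub 0 (mem_set A0) : E)) x.
Proof.
move=> cA x; have [c0|cx] := pselect (germ0 c x); first exact: germ0_rank_le.
have := rank_le_omega_pow (Sub x (mem_set (cA _ cx))) cA.
have := A_le0 (cA _ cx); rewrite le_eqVlt => /predU1P[x0|x0].
  by congr (rank_le _ _ (omega_pow _) _); apply/val_inj.
apply: (rank_le_mono hltG); apply: omega_pow_lt.
by rewrite ltEsub.
Qed.

Lemma rank_factor (y z : H) a : [set x | ~ germ0 y x] `<=` A -> [set x | ~ germ0 z x] `<=` A ->
  rank_eq hlt (y * z) a 0 -> (forall x, x < 0 -> rank_lt hlt (y * z) a x) ->
  exists a1 a2, [/\ rank_eq hlt y a1 0, rank_eq hlt z a2 0, a1 + a2 = a,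
    a1 = 0 -> y = const (y 0) & a2 = 0 -> z = const (z 0)].
Proof.
move=> yA zA yza yzx.
have ny : ~ germ0 y 0 by move=> y0; apply: yza.2; left; apply: germ0_mull.
have nz : ~ germ0 z 0 by move=> z0; apply: yza.2; left; apply: germ0_mulr.
have [b _ yb] := rank_eq_exists hltG (rank_le_top yA 0) ny.
have [c _ zc] := rank_eq_exists hltG (rank_le_top zA 0) nz.
have bca : b + c = a.
  by apply: (rank_eq_inj hltG _ yza); apply: (rank_mul charK (wo_sub_wf woA)).
(* The first points [x] and [w] where the ranks of [y] and [z] are maximal add up to
   a point where the rank of [y * z] is maximal, and this point can only be 0. *)
have [b' [x [yb' yle ylt]]] := max_rank hltG ny (rank_le_top yA).
have [c' [w [zc' zle zlt]]] := max_rank hltG nz (rank_le_top zA).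
have x0 : x <= 0 by apply: (@nongerm0_le0 _ _ y) => y0; apply: yb'.2; left.
have w0 : w <= 0 by apply: (@nongerm0_le0 _ _ z) => z0; apply: zc'.2; left.
have shift_eq (f : H) u v : rank_eq hlt f u v -> rank_eq hlt (hshift v f) u 0.
  by move=> [fu nfu]; split; [apply/(rank_le_hshift hltG)|move/(rank_lt_hshift hltG)].
(* In any other pair [t], [x + w - t], one entry lies to the left of [x] or of [w], where the rank
   is not yet maximal. *)
have xw : rank_lt hlt (hshift (x + w) (y * z) - hshift x y * hshift w z) (b' + c') 0.
  have := @mul_local _ _ _ _ hltG (b' + c') [:: x] y z (x + w) isT.
  rewrite big_seq1 [x + w - x]addrAC subrr add0r; apply => t.
  rewrite inE neq_lt => /orP[tx|xt].
    apply: (rank_lt_mull hltG); first exact/(rank_lt_hshift hltG)/ylt.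
    by apply/(rank_le_hshift hltG).
  apply: (rank_lt_mulr hltG); first by apply/(rank_le_hshift hltG).
  by apply/(rank_lt_hshift hltG)/zlt; lra.
have nyz : ~ rank_lt hlt (y * z) (b' + c') (x + w).
  move=> /(rank_lt_hshift hltG) yzw.
  have [_ + ] := rank_mul charK (wo_sub_wf woA) (shift_eq _ _ _ yb') (shift_eq _ _ _ zc').
  by apply; have := hrank_ltB hltG yzw xw; rewrite subKr.
have ge_max (f : H) u v : rank_eq hlt f u 0 -> rank_le hlt f v 0 -> ~ hlt v u.
  by move=> [_ nfu] fv vu; apply: nfu; right; exists v.
have nbb' := ge_max _ _ _ yb (yle 0); have ncc' := ge_max _ _ _ zc (zle 0).
have abc : ~ hlt (b' + c') a by rewrite -bca; apply: (vlt_leD hltG).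
have xw0 : x + w = 0.
  apply/eqP; rewrite eq_le; apply/andP; split; first lra.
  rewrite leNgt; apply/negP => xw0; apply: nyz.
  by apply: (rank_lt_weak hltG abc); apply: yzx.
have xE : x = 0 by lra.
have wE : w = 0 by lra.
rewrite {}xE in yb' ylt; rewrite {}wE in zc' zlt.
(* No value is below 0, so rank less than 0 to the left of 0 means that all germs there vanish. *)
have eqc (f : H) u : rank_eq hlt f 0 0 -> rank_eq hlt f u 0 -> (forall t, t < 0 -> rank_lt hlt f u t) ->
    f = const (f 0).
  move=> f0 fu flt; apply/hahnP => t /=; have [->//|t0] := eqVneq t 0.
  have [tp|tn|/eqP] := ltgtP t 0; [|exact: coef_gt0|by rewrite (negbTE t0)].
  have := flt t tp; rewrite -(rank_eq_inj hltG f0 fu) => -[[r rt fr]|[v /hess_lt0//]].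
  by apply: fr; rewrite rt lexx.
exists b, c; split => // [b0|c0]; [apply: (eqc _ _ _ _ ylt)|apply: (eqc _ _ _ _ zlt)] => //.
  by rewrite -b0.
by rewrite -c0.
Qed.

End RankValues.

(** The map identifies [G1] with an initial segment of [G2], and a rank refers only to smaller
    values. *)
Lemma rank_le_embed (G1 G2 : nmodType) (lt1 : G1 -> G1 -> Prop) (lt2 : G2 -> G2 -> Prop)
    (phi : G1 -> G2) (f : R -> K) : value_order lt1 ->
  (forall a b, lt1 a b -> lt2 (phi a) (phi b)) ->
  (forall a b, lt2 b (phi a) -> exists2 a', lt1 a' a & b = phi a') ->
  forall a x, rank_le lt1 f a x <-> rank_le lt2 f (phi a) x.
Proof.
move=> lt1G phi_lt phi_initial a; elim/(well_founded_ind (vlt_wf lt1G)): a => a IH x.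
split=> /rank_leP[r rx fr]; apply/rank_leP; exists r => // y /fr[|[b ba fb]].
- by left.
- by right; exists (phi b); [exact: phi_lt|apply/IH].
- by left.
- by right; have [a' a'a Eb] := phi_initial _ _ ba; exists a' => //; apply/IH; rewrite -?Eb.
Qed.

Lemma rank_lt_embed (G1 G2 : nmodType) (lt1 : G1 -> G1 -> Prop) (lt2 : G2 -> G2 -> Prop)
    (phi : G1 -> G2) (f : R -> K) : value_order lt1 ->
  (forall a b, lt1 a b -> lt2 (phi a) (phi b)) ->
  (forall a b, lt2 b (phi a) -> exists2 a', lt1 a' a & b = phi a') ->
  forall a x, rank_lt lt1 f a x <-> rank_lt lt2 f (phi a) x.
Proof.
move=> lt1G phi_lt phi_initial a x; have E := rank_le_embed f lt1G phi_lt phi_initial.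
split=> [[|[b ba /E fb]]|[|[b /phi_initial[a' a'a ->] /E fb]]]; try by left.
  by right; exists (phi b) => //; exact: phi_lt.
by right; exists a'.
Qed.

(** The naturals are embedded as multiples of the least generator [omega_pow bot]. Multiplicities
    add without cancellation, so two values whose sum is such a multiple are such multiples
    themselves. *)
Lemma nat_rank_factor (y z : H) (n : nat) :
  rank_eq natlt (y * z) n 0 -> (forall x, x < 0 -> rank_lt natlt (y * z) n x) ->
  exists p q : nat, [/\ rank_eq natlt y p 0, rank_eq natlt z q 0, (p + q)%N = n,
    p = 0%N -> y = const (y 0) & q = 0%N -> z = const (z 0)].
Proof.
move=> yzn yzx.
pose A := ([set x | ~ germ0 y x] `|` [set x | ~ germ0 z x]) `|` [set 0].
have woA : well_ordered A.
  apply: well_orderedU (@well_ordered1 R 0).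
  by apply: well_orderedU; exact: nongerm0_wo.
have A0 : A 0 by right.
have A_le0 x : A x -> x <= 0.
  by move=> [[/nongerm0_le0|/nongerm0_le0]|->].
have [||m Am lbm] := (well_orderedP A).1 woA A; [by []|by exists 0|].
pose bot : wo_sub A := Sub m (mem_set Am).
have botP (e : wo_sub A) : (bot <= e)%O by rewrite leEsub; apply/lbm/set_mem/valP.
pose phi p := omega_pow bot *+ p.
have mult_phi p e : mult (phi p) e = (p * (e == bot))%N by rewrite multMn mult1.
have phi_eq a : (forall e, e != bot -> mult a e = 0%N) -> a = phi (mult a bot).
  move=> H; apply/hessP => e; rewrite mult_phi.
  by case: eqVneq => [->|/H ->]; rewrite ?muln1 ?muln0.
have phi_lt p q : natlt p q -> hess_lt (phi p) (phi q).
  move=> pq; exists bot => [|e be]; rewrite !mult_phi ?eqxx ?muln1 //.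
  by rewrite (gt_eqF be) !muln0.
have phi_initial p a : hess_lt a (phi p) -> exists2 q, natlt q p & a = phi q.
  move=> [e]; rewrite mult_phi; have [->|] := eqVneq e bot; last by rewrite muln0.
  rewrite muln1 => ap Ea; exists (mult a bot) => //; apply: phi_eq => f fb.
  rewrite Ea ?mult_phi ?(negbTE fb) ?muln0 //.
  by rewrite lt_neqAle eq_sym fb botP.
have embed_le f := @rank_le_embed _ _ _ _ phi f nat_value_order phi_lt phi_initial.
have embed_lt f := @rank_lt_embed _ _ _ _ phi f nat_value_order phi_lt phi_initial.
have embed (f : R -> K) p x : rank_eq natlt f p x <-> rank_eq (@hess_lt _ _) f (phi p) x.
  by split=> -[fp nfp]; split; [apply/embed_le|move=> /embed_lt|apply/embed_le|move=> /embed_lt].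
have [||||a1 [a2 [ya za a12 y0 z0]]] := @rank_factor A woA A0 A_le0 y z (phi n).
- by move=> x yx; left; left.
- by move=> x zx; left; right.
- exact/embed.
- by move=> x /yzx/embed_lt.
have Ephi e : mult a1 e + mult a2 e = (n * (e == bot))%N by rewrite -mult_phi -a12 multD.
have E1 : a1 = phi (mult a1 bot).
  apply: phi_eq => e eb; have := Ephi e; rewrite (negbTE eb) muln0 => /eqP.
  by rewrite addn_eq0 => /andP[/eqP].
have E2 : a2 = phi (mult a2 bot).
  apply: phi_eq => e eb; have := Ephi e; rewrite (negbTE eb) muln0 => /eqP.
  by rewrite addn_eq0 => /andP[_ /eqP].
exists (mult a1 bot), (mult a2 bot); split.
- by apply/embed; rewrite -E1.
- by apply/embed; rewrite -E2.
- by have := Ephi bot; rewrite eqxx muln1.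
- by move=> a0; apply: y0; rewrite E1 a0.
- by move=> a0; apply: z0; rewrite E2 a0.
Qed.

End Factors.

(** * Ranks and order types *)

Section OrderTypeRank.
Variables (R : realType) (K : fieldType).
Implicit Types (f g : R -> K) (x y : R).

Lemma rank_le_supp (G : nmodType) (lt : G -> G -> Prop) f g a x :
  (forall y, f y = 0 -> g y = 0) -> rank_le lt f a x -> rank_le lt g a x.
Proof.
move=> fg; have fg0 y : germ0 f y -> germ0 g y.
  by move=> [e ey f0]; exists e => // t /f0/fg.
move: a x; fix IH 3 => a x [{}a {}x e ex H].
apply: (RankLe ex) => y /H[/fg0|]; first by left.
by move=> [b ba fb]; right; exists b => //; apply: IH.
Qed.

Lemma rank_lt_supp (G : nmodType) (lt : G -> G -> Prop) f g a x :
  (forall y, f y = 0 -> g y = 0) -> rank_lt lt f a x -> rank_lt lt g a x.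
Proof.
move=> fg [[e ex f0]|[b ba fb]]; first by left; exists e => // y /f0/fg.
by right; exists b => //; exact: rank_le_supp fb.
Qed.

Definition tcons n (k : nat) (t : n.-tuplelexi nat) : n.+1.-tuplelexi nat := [tuple of k :: t].

Lemma tcons_surj n (t : n.+1.-tuplelexi nat) : exists k u, t = tcons k u.
Proof. by case/tupleP: t => k u; exists k, u; apply/val_inj. Qed.

Lemma le_tcons n k l (t u : n.-tuplelexi nat) :
  (tcons k t <= tcons l u)%O = (k < l)%N || (k == l) && (t <= u)%O.
Proof.
rewrite -[LHS]/((k :: t : seqlexi nat) <= (l :: u : seqlexi nat))%O lexi_cons !leEnat.
by case: ltngtP.
Qed.

Lemma lt_tcons n k l (t u : n.-tuplelexi nat) : (k < l)%N -> (tcons k t < tcons l u)%O.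
Proof. by move=> kl; rewrite ltNge le_tcons; case: ltngtP kl. Qed.

(** Induction on [n]: fixing the first entry cuts the range into consecutive blocks of type omega^n,
    whose suprema increase to that of the range. *)
Lemma order_type_rank n (f : n.-tuplelexi nat -> R) g M :
  {mono f : s t / (s <= t)%O >-> s <= t} -> supp g = range f -> (forall t, f t <= M) ->
  [/\ rank_eq natlt g n (sup (range f)), forall x, x < sup (range f) -> rank_lt natlt g n x &
    forall x, sup (range f) < x -> germ0 g x].
Proof.
have germ0_lt m h z : germ0 h z -> rank_lt natlt h m z by left.
elim: n f g M => [|n IH] f g M f_mono gf fM.
  have rangef : range f = [set f [tuple]].
    apply/seteqP; split=> [_ [t _ <-]|_ ->]; last by exists [tuple].
    by congr (f _); exact: tuple0.
  have g0 x : x != f [tuple] -> g x = 0.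
    move=> xf; apply/eqP; rewrite -[_ == _]negbK; apply/negP => gx.
    have : supp g x by []. 
    by rewrite gf rangef /= => /eqP; rewrite (negbTE xf).
  have gn0 : g (f [tuple]) != 0.
    by have : supp g (f [tuple]) by rewrite gf; exists [tuple].
  rewrite rangef sup1; have gl x : x < f [tuple] -> germ0 g x.
    move=> xf; exists (x - 1) => [|y /andP[_ yx]]; first by rewrite gtrBl.
    by apply: g0; rewrite lt_eqF // (le_lt_trans yx).
  split.
  - split; first by apply/rank_leP; exists (f [tuple] - 1) => [|y /andP[_ /gl]];
      [rewrite gtrBl|left].
    case=> [[e ef ge]|[[]//]].
    by move: gn0; rewrite ge ?eqxx // ef lexx.
  - by move=> x /gl; left.
  - move=> x fx; exists (f [tuple]) => // y /andP[fy _].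
    by apply: g0; rewrite gt_eqF.
have f_lt : {mono f : s t / (s < t)%O >-> s < t} := leW_mono f_mono.
pose fk k t := f (tcons k t).
have fk_mono k : {mono fk k : s t / (s <= t)%O >-> s <= t}.
  by move=> s t; rewrite /fk f_mono le_tcons ltnn eqxx.
have fkM k t : fk k t <= M := fM (tcons k t).
pose gk k x := if `[< range (fk k) x >] then g x else 0.
have supp_gk k : supp (gk k) = range (fk k).
  apply/seteqP; split=> x; rewrite /supp /gk /=; first by case: asboolP; rewrite ?eqxx.
  move=> [t _ <-]; case: asboolP => [_|[]]; last by exists t.
  by have : supp g (fk k t) by rewrite gf; exists (tcons k t).
pose s k := sup (range (fk k)).
have t0 : n.-tuplelexi nat := [tuple of nseq n 0%N].
have range_fk k : has_sup (range (fk k)).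
  by split; [exists (fk k t0), t0|exists M => _ [t _ <-]].
have range_f : has_sup (range f).
  by split; [exists (fk 0%N t0), (tcons 0%N t0)|exists M => _ [t _ <-]].
have fks k t : fk k t <= s k by apply: ub_le_sup; [case: (range_fk k)|exists t].
have skf k t : s k <= fk k.+1 t.
  apply: ge_sup => [|_ [u _ <-]]; first by case: (range_fk k).
  by rewrite ltW // f_lt lt_tcons.
have fsup t : f t <= sup (range f) by apply: ub_le_sup; [case: range_f|exists t].
have sksup k : s k < sup (range f).
  apply: le_lt_trans (skf k t0) _; apply: lt_le_trans (fsup (tcons k.+2 t0)).
  by rewrite f_lt lt_tcons.
have IHk k := IH _ (gk k) M (fk_mono k) (supp_gk k) (fkM k).
have gk_small k x : rank_lt natlt (gk k) n.+1 x.
  have [[gs _] gl gr] := IHk k; case: (ltgtP x (s k)) => [xs|sx|->].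
  - by apply: (rank_lt_mono nat_value_order _ (gl x xs)); exact: ltnSn.
  - by left; apply: gr.
  - by right; exists n; first exact: ltnSn.
(* The first [k] blocks together; left of the supremum every germ of [g] is a germ of some [h k]. *)
pose h k x := if `[< exists2 j, (j < k)%N & range (fk j) x >] then g x else 0.
have h_small k x : rank_lt natlt (h k) n.+1 x.
  elim: k => [|k IHh].
    left; exists (x - 1) => [|y _]; first by rewrite gtrBl.
    by rewrite /h; case: asboolP => // -[].
  suff -> : h k.+1 = h k \+ gk k by apply: (rank_ltD nat_value_order).
  apply/funext => y; rewrite /h /gk /=.
  case: (asboolP (range (fk k) y)) => [[t _ fy]|nk].
    rewrite (asboolT (_ : exists2 j, (j < k.+1)%N & range (fk j) y)); last first.
      by exists k => //; exists t.
    rewrite asboolF ?add0r // => -[j jk [u _ fu]].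
    have : fk j u < fk k t by rewrite f_lt lt_tcons.
    by rewrite fu fy ltxx.
  rewrite addr0; case: asboolP => [[j + jy]|nj].
    rewrite ltnS leq_eqVlt => /predU1P[jk|jk]; first by case: nk; rewrite -jk.
    by rewrite asboolT //; exists j.
  by rewrite asboolF // => -[j jk jy]; apply: nj; exists j => //; exact: ltnW.
have g_small x : x < sup (range f) -> rank_lt natlt g n.+1 x.
  move=> xs; have [|_ [t _ <-]] := sup_adherent (_ : 0 < sup (range f) - x) range_f.
    by rewrite subr_gt0.
  rewrite subKr; have [k [u ->]] := tcons_surj t => xf.
  apply: (germ_eq_rank_lt nat_value_order _ (h_small k.+1 x)).
  exists (-1) => [|r /andP[_ r0]]; first lra.
  have yx : x + r <= x by lra.
  move: (x + r) yx => y yx; rewrite /h; case: asboolP => // nj.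
  apply/esym/eqP; rewrite -[_ == _]negbK; apply/negP => gy.
  have : supp g y by []. rewrite gf => -[v _ fv].
  have [j [w vE]] := tcons_surj v; apply: nj; exists j; last by exists w; rewrite // /fk -vE.
  rewrite ltnNge; apply/negP => kj.
  have : f (tcons k u) < f (tcons j w) by rewrite f_lt lt_tcons.
  rewrite -vE fv => /(lt_trans xf); lra.
split=> //.
- split.
    apply/rank_leP; exists (sup (range f) - 1) => [|y /andP[_ /g_small]//].
    by rewrite gtrBl.
  (* Rank at most [n] at the supremum would force rank below [n] nearby, but late blocks already
     have rank [n] at their own suprema. *)
  move=> gs; have gn : rank_le natlt g n (sup (range f)).
    case: gs => [|[b bn gb]]; first exact: germ0_rank_le.
    apply: (rank_le_weak nat_value_order _ gb); rewrite /natlt => nb.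
    by move: bn; rewrite /natlt ltnS leqNgt nb.
  have [e es ge] := (rank_leP natlt g n (sup (range f))).1 gn.
  have [|_ [t _ <-]] := sup_adherent (_ : 0 < sup (range f) - e) range_f.
    by rewrite subr_gt0.
  rewrite subKr; have [k [u ->]] := tcons_surj t => ef.
  have [[_ ngs] _ _] := IHk k; apply: ngs.
  apply: (rank_lt_supp (f := g)) => [y gy|]; first by rewrite /gk gy if_same.
  by apply: ge; rewrite sksup andbT (lt_le_trans ef) // fks.
- move=> x sx; exists (sup (range f)) => // y /andP[sy _].
  apply/eqP; rewrite -[_ == _]negbK; apply/negP => gy.
  have : supp g y by []. rewrite gf => -[v _ fv].
  by move: sy; rewrite -fv ltNge fsup.
Qed.

Lemma P_omega_pow_rank n (b : hahn R K) : (0 < n)%N -> P_omega_pow n b ->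
  [/\ rank_eq natlt b n 0, forall x, x < 0 -> rank_lt natlt b n x & b 0 = 0].
Proof.
move=> n0 [[f [f_mono rf]] supb].
have f0 t : f t <= 0 by apply: (@hahn_le0 _ _ b); rewrite -rf; exists t.
have := order_type_rank f_mono (esym rf) f0; rewrite rf supb => -[b1 b2 _]; split=> //.
apply/eqP; rewrite -[_ == _]negbK; apply/negP => b0.
have : supp b 0 by []. rewrite -rf => -[t _ ft].
case: n n0 f t f_mono rf f0 ft {b1 b2} => // n _ f t f_mono rf f0 ft.
have [k [u tE]] := tcons_surj t.
(* For positive [n] there is no largest tuple, so the supremum 0 is not in the support. *)
have := f0 (tcons k.+1 u); rewrite leNgt -ft tE (leW_mono f_mono).
by rewrite lt_tcons.
Qed.

End OrderTypeRank.

(** * Decomposable germs and random series *)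

Section RationalEmbedding.
Variables (K : fieldType) (charK : [pchar K] =i pred0).

Lemma intr_eq0_char0 (d : int) : (d%:~R == 0 :> K) = (d == 0).
Proof.
have /pcharf0P natK := charK.
by case: d => n; rewrite ?NegzE ?mulrNz ?oppr_eq0 -?pmulrn natK.
Qed.

Lemma ratr_mul_denom (x : rat) (m d : int) : x * d%:~R = m%:~R -> ratr x * d%:~R = m%:~R :> K.
Proof.
move=> E; have den0 : (denq x)%:~R != 0 :> K by rewrite intr_eq0_char0 denq_neq0.
have {}E : numq x * d = m * denq x.
  by apply/(@intr_inj rat); rewrite !rmorphM /= -E numqE mulrAC.
by rewrite /ratr mulrAC -rmorphM /= E rmorphM /= mulfK.
Qed.

Lemma ratr_char0_zmod : zmod_morphism (@ratr K).
Proof.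
move=> x y; have d0 z : (denq z)%:~R != 0 :> K by rewrite intr_eq0_char0 denq_neq0.
apply: (mulIf (mulf_neq0 (d0 x) (d0 y))); rewrite -rmorphM /=.
rewrite (ratr_mul_denom (m := numq x * denq y - numq y * denq x)); last first.
  by rewrite rmorphB !rmorphM /= mulrBl !numqE mulrA [in RHS]mulrAC; congr (_ - _); ring.
rewrite rmorphB !rmorphM /= mulrBl -(ratr_mul_denom (esym (numqE x))).
by rewrite -(ratr_mul_denom (esym (numqE y))); ring.
Qed.

Lemma ratr_char0_monoid : monoid_morphism (@ratr K).
Proof.
have d0 z : (denq z)%:~R != 0 :> K by rewrite intr_eq0_char0 denq_neq0.
split=> [|x y]; first by rewrite -[1]/(1%:~R) ratr_int.
apply: (mulIf (mulf_neq0 (d0 x) (d0 y))); rewrite -rmorphM /=.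
rewrite (ratr_mul_denom (m := numq x * numq y)); last by rewrite !rmorphM /= !numqE; ring.
rewrite rmorphM /= -(ratr_mul_denom (esym (numqE x))) -(ratr_mul_denom (esym (numqE y))).
ring.
Qed.

(* The unused argument lets the morphism instance recover [charK]. *)
Definition ratr_char0 (_ : [pchar K] =i pred0) : rat -> K := @ratr K.
HB.instance Definition _ := GRing.isZmodMorphism.Build rat K (ratr_char0 charK) ratr_char0_zmod.
HB.instance Definition _ := GRing.isMonoidMorphism.Build rat K (ratr_char0 charK) ratr_char0_monoid.

End RationalEmbedding.

(** With a separate variable for each nonzero entry, the determinant is a nonzero polynomial: the
    nonzero diagonal lets it specialize to the identity matrix. Algebraic independence forbids its
    vanishing at the actual entries. *)
Lemma Q_alg_indep_det_neq0 (K : fieldType) (charK : [pchar K] =i pred0) (I : Type)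
    (A : set I) (v : I -> K) N (X : 'I_N -> 'I_N -> I) :
  Q_alg_indep A v -> (forall g, A g <-> v g != 0) ->
  (forall i j k l, X i j = X k l -> (i, j) = (k, l)) ->
  (forall i, A (X i i)) -> \det (\matrix_(i, j) v (X i j)) != 0.
Proof.
move=> indep Av X_inj diag.
pose S := [set ij : 'I_N * 'I_N | v (X ij.1 ij.2) != 0]%SET.
pose x (k : 'I_#|S|) := X (enum_val k).1 (enum_val k).2.
pose P : 'M[mpoly.mpoly #|S| rat]_N :=
  \matrix_(i, j) \sum_(k < #|S| | enum_val k == (i, j)) mpoly.mpolyX rat (mpoly.mnm1 k).
have sumS (V : nmodType) (F : 'I_#|S| -> V) (y : V) i j :
    (forall k, enum_val k = (i, j) -> F k = y) -> ((i, j) \notin S -> y = 0) ->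
    \sum_(k < #|S| | enum_val k == (i, j)) F k = y.
  move=> Fy y0; case: (boolP ((i, j) \in S)) => ijS.
    rewrite (big_pred1 (enum_rank_in ijS (i, j))) => [|k].
      by apply: Fy; rewrite enum_rankK_in.
    apply/eqP/eqP => [E|->]; last by rewrite enum_rankK_in.
    by apply: enum_val_inj; rewrite enum_rankK_in.
  rewrite big_pred0 ?y0 // => k; apply: contraNF ijS => /eqP <-.
  exact: enum_valP.
have P0 : \det P != 0.
  pose e (k : 'I_#|S|) : rat := ((enum_val k).1 == (enum_val k).2)%:R.
  apply/eqP => /(congr1 (mpoly.meval e)); rewrite rmorph0 -det_map_mx.
  suff -> : map_mx (mpoly.meval e) P = 1%:M by rewrite det1 => /eqP; rewrite oner_eq0.
  apply/matrixP => i j; rewrite !mxE rmorph_sum /=; apply: sumS => [k kij|].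
    by rewrite mpoly.mevalXU /e kij.
  by case: eqVneq => // <-; rewrite inE /= => /negP[]; apply/Av.
apply: contraNneq P0 => det0; apply/eqP/(indep _ x).
- move=> k l; rewrite /x => /X_inj E; apply: enum_val_inj.
  by move: E; case: (enum_val k) (enum_val l) => ? ? [].
- by move=> k; apply/Av; have := enum_valP k; rewrite inE.
rewrite -[mpoly.mmap _ _ _]/(mpoly.mmap (ratr_char0 charK) (v \o x) (\det P)).
rewrite -det_map_mx -[RHS]det0; congr (\det _); apply/matrixP => i j.
rewrite !mxE rmorph_sum /=; apply: sumS => [k kij|].
  by rewrite mpoly.mmapX mpoly.mmap1U /= /x kij.
by rewrite inE negbK => /eqP.
Qed.

Section FiniteChoices.
Variable R : realType.
Implicit Types x y z e : R.

Lemma forall_left (I : finType) (Q : I -> R -> Prop) :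
  (forall i, exists2 e, e < 0 & forall z, e < z < 0 -> Q i z) ->
  exists2 e, e < 0 & forall i z, e < z < 0 -> Q i z.
Proof.
move=> HQ; suff [e e0 He] : exists2 e, e < 0 &
    forall i, i \in enum I -> forall z, e < z < 0 -> Q i z.
  by exists e => // i; apply: He; rewrite mem_enum.
elim: (enum I) => [|i s [e e0 He]]; first by exists (-1) => //; rewrite ltrN10.
have [e' e'0 He'] := HQ i; exists (Num.max e e'); first by rewrite gt_max e0.
move=> k; rewrite inE => /predU1P[->|ks] z; rewrite gt_max => /andP[/andP[ez e'z] z0].
  by apply: He'; rewrite e'z.
by apply: He; rewrite ?ez.
Qed.

Lemma choose_left (I : finType) (Q : I -> R -> Prop) :
  (forall i e, e < 0 -> exists2 z, e < z < 0 & Q i z) ->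
  forall e, e < 0 -> exists2 w : I -> R, injective w & forall i, e < w i < 0 /\ Q i (w i).
Proof.
move=> HQ e e0; suff [w w_inj wP] : exists2 w : I -> R, {in enum I &, injective w} &
    forall i, i \in enum I -> e < w i < 0 /\ Q i (w i).
  by exists w => [i j|i]; [apply: w_inj|apply: wP]; rewrite mem_enum.
elim: (enum I) => [|i s [w w_inj wP]]; first by exists (fun=> 0).
have [a a0 /allP aw] := seq_lt_bound (e :: map w s) 0.
have [z /andP[az z0] Qz] := HQ i a a0.
have ea : e < a by have := aw e (mem_head _ _); rewrite e0.
have [is_|is_] := boolP (i \in s).
  exists w => [j k|j]; rewrite !inE.
    by move=> /predU1P[->|js] /predU1P[->|ks]; apply: w_inj.
  by move=> /predU1P[->|js]; apply: wP.
exists (fun k => if k == i then z else w k) => [j k|j]; rewrite !inE.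
  have wz l : l \in s -> w l < z.
    move=> ls; apply: lt_trans az.
    have [/andP[_ wl0] _] := wP l ls.
    by have := aw (w l); rewrite inE map_f // orbT wl0 => /(_ isT).
  move=> /predU1P[->|js] /predU1P[->|ks]; rewrite ?eqxx //.
  - by case: eqP => [->//|_ E]; have := wz _ ks; rewrite -E ltxx.
  - by case: eqP => [->//|_ E]; have := wz _ js; rewrite E ltxx.
  by rewrite !ifN; [exact: w_inj|apply: contraNneq is_ => <-..].
move=> /predU1P[->|js]; first by rewrite eqxx z0 (lt_trans ea).
by rewrite ifN; [exact: wP|apply: contraNneq is_ => <-].
Qed.

(** [e] is chosen above every negative difference of two of the points, so shifts smaller than [- e]
    cannot bridge a gap. *)
Lemma separation (I : finType) (x : I -> R) : exists2 e, e < 0 &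
  forall i j u v, x i != x j -> e < u < 0 -> e < v < 0 -> x i + u != x j + v.
Proof.
have [e e0 /allP He] := seq_lt_bound [seq x i - x j | i <- enum I, j <- enum I] 0.
exists e => // i j u v xij /andP[eu u0] /andP[ev v0].
have gap k l : x k < x l -> x k - x l < e.
  move=> xkl; have := He (x k - x l); rewrite subr_lt0 xkl; apply.
  by apply/allpairsP; exists (k, l); rewrite !mem_enum.
apply/eqP => E; move: xij; rewrite neq_lt => /orP[/gap|/gap]; lra.
Qed.

End FiniteChoices.

(** * Descent of decomposable germs *)

Section Decomposable.
Variables (R : realType) (K : fieldType).
Local Notation H := (hahn R K).
Local Notation rank_le := (rank_le natlt).
Local Notation rank_lt := (rank_lt natlt).
Local Notation rank_eq := (rank_eq natlt).
Implicit Types (c d f g : H) (z : R).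
Let ltG := nat_value_order.

Lemma rank_ltS (f : R -> K) m x : rank_lt f m.+1 x <-> rank_le f m x.
Proof.
split=> [[|[b]]|fm]; first exact: germ0_rank_le.
  by rewrite /natlt ltnS => bm; apply: (rank_le_weak ltG); rewrite /natlt ltnNge bm.
by right; exists m => //; rewrite /natlt ltnSn.
Qed.

Lemma rank_lt1P (f : R -> K) x :
  rank_lt f 1 x <-> exists2 e, e < x & forall y, e < y < x -> f y = 0.
Proof.
rewrite rank_ltS rank_leP; split=> -[e ex fe]; exists e => // y exy.
  have [|[r ry fr]|[[]//]] := fe y; first by [].
  by apply: fr; rewrite ry lexx.
left; exists e; first by case/andP: exy.
by move=> t /andP[et ty]; apply: fe; lra.
Qed.

(** [p] and [q] are only upper bounds for ranks, so scaling and taking germs at nearby points stay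
    within this form. *)
Inductive decomposable (m : nat) : H -> Prop :=
| DecSmall f : rank_lt f m 0 -> decomposable m f
| DecMul p q c d : (p + q)%N = m -> (0 < p)%N -> (0 < q)%N ->
    rank_le c p 0 -> rank_le d q 0 -> decomposable m (c * d)
| DecAdd f g : decomposable m f -> decomposable m g -> decomposable m (f + g).

Lemma dec_scale m k f : decomposable m f -> decomposable m (const k * f).
Proof.
elim=> {f} [f fm|p q c d pq p0 q0 cp dq|f g _ fD _ gD].
- by apply/DecSmall/(hrank_ltZ ltG).
- by rewrite mulrA; apply: (DecMul pq) => //; apply: (hrank_leZ ltG).
- by rewrite mulrDr; apply: DecAdd.
Qed.

Lemma dec_sum m (I : Type) (r : seq I) (P : pred I) (F : I -> H) :
  (forall i, P i -> decomposable m (F i)) -> decomposable m (\sum_(i <- r | P i) F i).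
Proof.
move=> FP; apply: (big_ind (decomposable m)) => // [|f g]; last exact: DecAdd.
by apply: DecSmall; exact: hrank_lt0.
Qed.

(** Each entry pairs a fixed series with a scalar depending on [z]; the length of [l] bounds the
    dimension to be eliminated. *)
Local Notation correction l z := (\sum_(kg <- l) const (kg.1 z) * kg.2).

(** For [p] at least 2 the germ of [c] at [z] still has a positive rank bound. For [p = 1] it is the
    constant [c z], so that a multiple of the fixed series [d] has to be removed. *)
Lemma dec_hshift_mul m p q c d : (p + q)%N = m.+1 -> (0 < p)%N -> (0 < q)%N ->
  rank_le c p 0 -> rank_le d q 0 ->
  exists l : seq ((R -> K) * H), exists2 e, e < 0 & forall z, e < z < 0 ->
    decomposable m (hshift z c * d - correction l z).
Proof.
move=> pq; case: p pq => // p pq _ q0 cp dq.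
have [e e0 ce] := rank_le_left ltG cp.
case: p pq cp ce => [|p] pq cp ce.
  exists [:: (coef c, d)]; exists e => // z ez; apply/DecSmall.
  rewrite big_seq1 -mulrBl; left; apply: germ0_mull.
  have /rank_lt1P[r r0 cr] := ce z ez; exists r => // y /andP[ry].
  rewrite coef_sub le_eqVlt => /predU1P[->|y0]; last first.
    by rewrite cr ?ry // add0r /= lt_eqF // oppr0.
  by rewrite hshiftE lexx addr0 /= eqxx subrr.
exists [::]; exists e => // z /ce/rank_ltS czp; rewrite big_nil subr0.
by apply: (DecMul (p := p.+1) (q := q)) => //; case: pq.
Qed.

Lemma dec_hshift m f : decomposable m.+1 f ->
  exists l : seq ((R -> K) * H), exists2 e, e < 0 & forall z, e < z < 0 ->
    decomposable m (hshift z f - correction l z).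
Proof.
elim=> {f} [f|p q c d pq p0 q0 cp dq|f g _ [l1 [e1 e10 H1]] _ [l2 [e2 e20 H2]]].
- move=> /rank_ltS/(rank_le_left ltG)[e e0 fe]; exists [::]; exists e => // z /fe fz.
  by rewrite big_nil subr0; apply: DecSmall.
- have [l1 [e1 e10 H1]] := dec_hshift_mul pq p0 q0 cp dq.
  have [l2 [e2 e20 H2]] := dec_hshift_mul (etrans (addnC q p) pq) q0 p0 dq cp.
  have [|e3 e30 H3] := leibniz ltG (w := m) cp dq.
    move=> s t sp tq; rewrite /natlt -[s + t]/(s + t)%N; move: sp tq pq; rewrite /natlt; lia.
  exists (l1 ++ l2); exists (Num.max (Num.max e1 e2) e3); first by rewrite !gt_max e10 e20.
  move=> z; rewrite !gt_max -!andbA => /and4P[e1z e2z e3z z0].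
  have {}H1 : decomposable m (hshift z c * d - correction l1 z) by apply: H1; rewrite e1z.
  have {}H2 : decomposable m (hshift z d * c - correction l2 z) by apply: H2; rewrite e2z.
  have {}H3 : rank_lt (hshift z (c * d) - (hshift z c * d + c * hshift z d)) m 0.
    by apply: H3; rewrite e3z.
  have := DecAdd (DecSmall H3) (DecAdd H1 H2); congr decomposable.
  rewrite big_cat [in RHS]opprD [hshift z d * c]mulrC /=.
  by rewrite [X in _ + X]addrACA [LHS]addrA subrK.
- exists (l1 ++ l2); exists (Num.max e1 e2); first by rewrite gt_max e10.
  move=> z; rewrite gt_max => /andP[/andP[e1z e2z] z0].
  rewrite hshiftD big_cat opprD addrACA /=; apply: DecAdd; [apply: H1|apply: H2].
    by rewrite e1z.
  by rewrite e2z.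
Qed.

Lemma dec1 f : decomposable 1 f -> rank_lt f 1 0.
Proof.
elim=> {f} [//|[|p] [|q] c d //|f g _ fm _ gm]; last exact: (hrank_ltD ltG).
by rewrite addnS.
Qed.

Lemma kernel_vector M (l : seq (R -> K)) (z : 'I_M -> R) : (size l < M)%N ->
  exists2 mu : 'I_M -> K, (exists i, mu i != 0) &
    forall k, (k < size l)%N -> \sum_i mu i * nth (fun=> 0) l k (z i) = 0.
Proof.
move=> lM; pose A : 'M[K]_(M, size l) := \matrix_(i, j) nth (fun=> 0) l j (z i).
have : kermx A != 0.
  rewrite -mxrank_eq0 mxrank_ker subn_eq0 -ltnNge; apply: leq_ltn_trans lM.
  exact: rank_leq_col.
case/rowV0Pn => v vA v0; exists (fun i => v 0 i).
  by apply: contra_neqP v0 => nv; apply/rowP => i; rewrite mxE; apply/eqP;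
    rewrite -[_ == _]negbK; apply/negP => vi; apply: nv; exists i.
move=> k kl; move/sub_kermxP/rowP: vA => /(_ (Ordinal kl)); rewrite !mxE => vA0; rewrite -[RHS]vA0.
by apply: eq_bigr => i _; rewrite !mxE.
Qed.

Lemma hshift_hshift x z c : z <= 0 -> hshift z (hshift x c) = hshift (x + z) c.
Proof.
move=> z0; apply/hahnP => g; rewrite !hshiftE; case: leP => // g0.
by rewrite ifT ?addrA //; lra.
Qed.

Lemma const_sum (I : Type) (r : seq I) (P : pred I) (F : I -> K) :
  \sum_(i <- r | P i) const (F i) = const (\sum_(i <- r | P i) F i) :> H.
Proof.
apply/esym; apply: (big_morph const) => [k l|]; last by apply/hahnP => g; rewrite /= if_same.
by apply/hahnP => g; rewrite Defs.coefD /=; case: ifP; rewrite ?addr0.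
Qed.

Section IndependentGerms.
Variable b : H.

(** The predicate [P] allows the descent to discard those points where the rank is too small. *)
Definition independent_germs (D : H -> Prop) (m : nat) :=
  forall (I : finType) (P : pred I) (lam : I -> K) (x : I -> R),
  {in P &, injective x} -> (exists i, P i) ->
  (forall i, P i -> lam i != 0 /\ rank_eq b m (x i)) ->
  ~ D (\sum_(i | P i) const (lam i) * hshift (x i) b).

(* A germ of rank m + 1 that decomposes has derivatives [hshift z] lying, modulo
   decomposable germs of rank m, in a space of finite dimension: combining more
   derivatives than this dimension gives a decomposable combination. *)
Lemma independent_not_decomposable m :
  independent_germs (fun f => rank_lt f 1 0) 1 ->
  independent_germs (decomposable m.+1) m.+1.
Proof.
move=> base; elim: m => [|m IH] I P lam x x_inj [i0 Pi0] HP.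
  by move=> /dec1; apply: base => //; exists i0.
move=> /dec_hshift[l [e e0 He]].
have [e1 e10 H1] : exists2 e1, e1 < 0 & forall i z, e1 < z < 0 -> P i -> rank_lt b m.+2 (x i + z).
  apply: forall_left => i; have [Pi|nPi] := boolP (P i); last by exists (-1); rewrite ?ltrN10.
  have [_ [/rank_leP[r rx br] _]] := HP i Pi; exists (r - x i); first lra.
  by move=> z rz _; apply: br; lra.
have [e2 e20 sep] := separation x.
pose e3 := Num.max e (Num.max e1 e2).
have e30 : e3 < 0 by rewrite !gt_max e0 e10.
(* One shift more than there are corrections. Exact rank is demanded only near [x i0], which keeps
   the new family nonempty. *)
have [|w w_inj wP] := @choose_left _ 'I_(size l).+1
    (fun _ z => ~ rank_lt b m.+1 (x i0 + z)) _ e3 e30.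
  move=> _ r r0; have nb : ~ rank_le b m.+1 (x i0).
    by have [_ [_ nb]] := HP i0 Pi0; move=> bm; apply/nb/rank_ltS.
  have [|y /andP[ry yx] by_] := rank_gt_left nb (e := x i0 + r); first by rewrite gtrDl.
  by exists (y - x i0); [lra|rewrite subrKC].
have wlt j : [/\ e < w j, e1 < w j, e2 < w j & w j < 0].
  by have [/andP[]] := wP j; rewrite !gt_max => /andP[-> /andP[-> ->]].
have [|mu [j0 muj0] mu0] := @kernel_vector _ (map fst l) w; first by rewrite size_map.
(* The remaining terms have coefficient 0 or rank below [m.+1], so dropping them preserves
   decomposability. *)
pose P' (ji : 'I_(size l).+1 * I) :=
  [&& P ji.2, mu ji.1 != 0 & `[< ~ rank_lt b m.+1 (x ji.2 + w ji.1) >]].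
apply: (IH _ P' (fun ji => mu ji.1 * lam ji.2) (fun ji => x ji.2 + w ji.1)).
- move=> [j i] [j' i'] /and3P[/= Pi _ _] /and3P[/= Pi' _ _] E.
  have [_ _ e2j wj] := wlt j; have [_ _ e2j' wj'] := wlt j'.
  have xE : x i = x i'.
    apply/eqP; case: eqP => // /eqP xii'.
    have := sep _ _ (w j) (w j') xii'; rewrite e2j wj e2j' wj' => /(_ isT isT).
    by rewrite E eqxx.
  by rewrite (x_inj i i') //; congr (_, _); apply/w_inj/(addrI (x i)); rewrite E xE.
- exists (j0, i0); rewrite /P' /= Pi0 muj0; apply/asboolP.
  by have [] := wP j0.
- move=> [j i] /and3P[/= Pi muj /asboolP nb]; have [lami _] := HP i Pi.
  split; first by rewrite mulf_neq0.
  by split => //; apply/rank_ltS/H1 => //; have [_ -> _ ->] := wlt j.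
pose T (ji : 'I_(size l).+1 * I) := const (mu ji.1 * lam ji.2) * hshift (x ji.2 + w ji.1) b.
have D : decomposable m.+1 (\sum_(ji | P ji.2) T ji).
  pose B := \sum_(i | P i) const (lam i) * hshift (x i) b.
  have : decomposable m.+1 (\sum_j const (mu j) * (hshift (w j) B - correction l (w j))).
    apply: dec_sum => j _; apply: dec_scale; apply: He.
    by have [-> _ _ ->] := wlt j.
  congr decomposable; under eq_bigr do rewrite mulrBr.
  rewrite sumrB [X in _ - X](_ : _ = 0) ?subr0; last first.
    under eq_bigr do rewrite mulr_sumr.
    rewrite exchange_big (big_nth (0, 0)) big_mkord big1 // => k _.
    under eq_bigr do rewrite mulrA -constM.
    rewrite -mulr_suml const_sum [X in const X](_ : _ = 0).
      by apply/hahnP => g; rewrite coef_const_mul mul0r.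
    rewrite -[RHS](mu0 k) ?size_map //; apply: eq_bigr => j _.
    by rewrite (nth_map (0, 0)).
  rewrite -(pair_big xpredT P (fun j i => T (j, i))) /=; apply: eq_bigr => j _.
  rewrite hshift_sum mulr_sumr; apply: eq_bigr => i _.
  by rewrite hshift_const_mul hshift_hshift ?mulrA -?constM //; have [_ _ _ /ltW] := wlt j.
rewrite (bigID P') /= in D.
have small : rank_lt (- \sum_(ji | P ji.2 && ~~ P' ji) T ji) m.+1 0.
  apply/(hrank_ltN ltG)/(hrank_lt_sum ltG) => ji _ /andP[Pi]; rewrite -[coef _]/(coef (T ji)) /P' Pi andTb.
  rewrite negb_and negbK => /orP[/eqP mu_j|/asboolPn/contrapT bm].
    suff -> : T ji = 0 by exact: hrank_lt0.
    by apply/hahnP => g; rewrite coef_const_mul mu_j !mul0r.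
  by apply/(hrank_ltZ ltG)/(rank_lt_hshift ltG).
have := DecAdd D (DecSmall small); rewrite addrK.
by congr decomposable; apply: eq_bigl => ji; rewrite /P'; case: (P ji.2).
Qed.

End IndependentGerms.
End Decomposable.

(** * Randomness and germs of rank 1 *)

Section RandomSeries.
Variables (R : realType) (K : fieldType) (charK : [pchar K] =i pred0).
Local Notation H := (hahn R K).
Local Notation rank_lt := (rank_lt natlt).
Local Notation rank_eq := (rank_eq natlt).
Variables (b : H) (b0 : b 0 = 0).

Lemma rank1_frequently x : ~ rank_lt b 1 x ->
  forall e, e < 0 -> exists2 h, e < h < 0 & b (x + h) != 0.
Proof.
move=> bx e e0; apply: contrapT => nh; apply/bx/rank_lt1P.
exists (x + e) => [|y /andP[ey yx]]; first by rewrite gtrDl.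
apply/eqP; rewrite -[_ == _]negbK; apply/negP => by_; apply: nh.
by exists (y - x); [lra|rewrite subrKC].
Qed.

Lemma rank1_closure x : ~ rank_lt b 1 x -> closure (supp b) x.
Proof.
move=> bx B /nbhs_ballP[e /= e0 eB].
have [|h /andP[eh h0] bh] := rank1_frequently bx (e := - e); first by rewrite oppr_lt0.
exists (x + h); split; first exact: bh.
by apply: eB; rewrite /ball /= opprD addNKr normrN ltr0_norm //; lra.
Qed.

(** Once [h] is chosen with [b (x i + h)] nonzero for one [i], every other term of the sum
    vanishes. *)
Lemma Q_lin_indep_germs (I : finType) (P : pred I) (lam : I -> K) (x : I -> R) :
  Q_lin_indep (closure (supp b) `\ 0) ->
  {in P &, injective x} -> (exists i, P i) ->
  (forall i, P i -> [/\ lam i != 0, x i != 0 & ~ rank_lt b 1 (x i)]) ->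
  forall e, e < 0 -> exists2 h, e < h < 0 & \sum_(i | P i) lam i * b (x i + h) != 0.
Proof.
move=> indep x_inj [i Pi] HP e e0; have [e2 e20 sep] := separation x.
have [lami xi bxi] := HP i Pi.
(* [separation] needs two negative shifts, so [x i != x j + h] is obtained after adding [h / 2] to
   both sides; halving [e2] keeps [h + h / 2] in range. *)
have [|h /andP[]] := rank1_frequently bxi (e := Num.max e (e2 / 2)).
  by rewrite gt_max e0 /=; lra.
rewrite gt_max => /andP[eh e2h] h0 bh; exists h; first by rewrite eh.
rewrite (bigD1 i) //= big1 ?addr0 ?mulf_neq0 // => j /andP[Pj ji].
have [_ xj bxj] := HP j Pj.
apply/eqP; rewrite mulf_eq0 -[b _ == 0]negbK; apply/orP; right; apply/negP => bjh.
have xij : x i != x j by apply: contraNneq ji => /(x_inj _ _ Pi Pj) ->.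
have xji : x j != x i by rewrite eq_sym.
have [d1 d2] : x i != x j + h /\ x j != x i + h.
  split; apply/eqP => E1; [have := sep _ _ (h / 2) (h + h / 2) xij|
    have := sep _ _ (h / 2) (h + h / 2) xji]; rewrite addrA -E1 eqxx;
    (have -> : e2 < h / 2 < 0 by lra);
    by (have -> : e2 < h + h / 2 < 0 by lra) => /(_ isT isT).
pose s := [:: x i; x j; x i + h; x j + h].
pose q : seq rat := [:: 1; -1; -1; 1].
have us : uniq s.
  have dh t : t != t + h by rewrite gt_eqF // gtrDl.
  by rewrite /= !inE !negb_or (inj_eq (addIr h)) xij d1 d2 !dh.
have nonzero t : b t != 0 -> t != 0 by apply: contraNneq => ->; rewrite b0.
have supp_closure t : b t != 0 -> (closure (supp b) `\ 0) t.
  by move=> bt; split; [exact: subset_closure|exact/eqP/nonzero].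
have rank1_closure0 t : t != 0 -> ~ rank_lt b 1 t -> (closure (supp b) `\ 0) t.
  by move=> t0 bt; split; [exact: rank1_closure|exact/eqP].
have s_inj : injective (fun k : 'I_4 => nth 0 s k).
  by move=> k l E; apply/val_inj/eqP; rewrite -(nth_uniq 0 _ _ us) ?ltn_ord //; exact/eqP.
have s_closure (k : 'I_4) : (closure (supp b) `\ 0) (nth 0 s k).
  case: k => -[|[|[|[|]]]] //= _; [exact: rank1_closure0|exact: rank1_closure0|
    exact: supp_closure|exact: supp_closure].
have relation : \sum_(k < 4) ratr (nth 0 q k) * nth 0 s k = 0.
  rewrite !big_ord_recl big_ord0 /=.
  have -> : ratr (-1) = -1 :> R by rewrite rmorphN rmorph1.
  by rewrite rmorph1; lra.
by have /(_ ord0)/eqP := indep 4 _ _ s_inj s_closure relation.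
Qed.

(** Shifts [w l] making the diagonal nonzero give an invertible matrix, so the nonzero row of
    scalars cannot annihilate every column; a surviving column yields [h]. *)
Lemma Q_alg_indep_germs (I : finType) (P : pred I) (lam : I -> K) (x : I -> R) :
  Q_alg_indep (supp b) b ->
  {in P &, injective x} -> (exists i, P i) ->
  (forall i, P i -> lam i != 0 /\ ~ rank_lt b 1 (x i)) ->
  forall e, e < 0 -> exists2 h, e < h < 0 & \sum_(i | P i) lam i * b (x i + h) != 0.
Proof.
move=> indep x_inj [i Pi] HP e e0; have [e2 e20 sep] := separation x.
have evP k : P (enum_val (A := P) k) by have := enum_valP k.
have acc k r : r < 0 -> exists2 h, r < h < 0 & b (x (enum_val (A := P) k) + h) != 0.
  by apply: rank1_frequently; have [] := HP _ (evP k).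
have [|w w_inj wP] := choose_left acc (e := Num.max e e2); first by rewrite gt_max e0.
have we k : [/\ e < w k, e2 < w k & w k < 0].
  by have [/andP[]] := wP k; rewrite gt_max => /andP[-> ->].
pose X k l := x (enum_val (A := P) k) + w l.
have det0 : \det (\matrix_(k, l) b (X k l)) != 0.
  apply: (Q_alg_indep_det_neq0 charK indep) => [//|k l k' l' E|k].
    have [_ ewl wl] := we l; have [_ ewl' wl'] := we l'.
    have xE : x (enum_val k) = x (enum_val k').
      apply/eqP; case: eqP => // /eqP xkk'.
      have := sep _ _ (w l) (w l') xkk'; rewrite ewl wl ewl' wl' => /(_ isT isT).
      by rewrite -[_ + _]/(X k l) E eqxx.
    have kk' : k = k' by apply/enum_val_inj/x_inj => //; apply: evP.
    by congr (_, _) => //; apply/w_inj/(addrI (x (enum_val k))); rewrite -[LHS]/(X k l) E kk'.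
  by have [] := wP k.
apply: contrapT => nh; case/negP: det0; apply/det0P.
exists (\row_k lam (enum_val (A := P) k)).
  apply: contraTneq isT => /rowP/(_ (enum_rank_in Pi i)); rewrite !mxE enum_rankK_in // => lami.
  by have [] := HP i Pi; rewrite lami eqxx.
apply/rowP => l; rewrite !mxE; apply/eqP; rewrite -[_ == _]negbK; apply/negP => sum0.
apply: nh; exists (w l); first by have [-> _ ->] := we l.
apply: contraNneq sum0 => sum0; rewrite -[X in _ == X]sum0; apply/eqP.
rewrite [RHS](eq_bigl (mem P)) // [RHS]big_enum_val; apply: eq_bigr => k _.
by rewrite !mxE.
Qed.

Lemma random_independent_germs : random b -> (forall x, rank_eq b 1 x -> x != 0) ->
  independent_germs b (fun f => rank_lt f 1 0) 1.
Proof.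
move=> b_random bx I P lam x x_inj P0 HP /rank_lt1P[e e0 sum0].
have [h eh] : exists2 h, e < h < 0 & \sum_(i | P i) lam i * b (x i + h) != 0.
  case: b_random => indep; [apply: Q_lin_indep_germs|apply: Q_alg_indep_germs] => // i /HP[lami];
    by case=> [bi nbi]; split => //; apply: bx.
suff -> : \sum_(i | P i) lam i * b (x i + h) =
    (\sum_(i | P i) const (lam i) * hshift (x i) b : H) h by rewrite sum0 ?eqxx.
rewrite [RHS](big_morph (fun f : H => f h) (fun f g => Defs.coefD f g h) (coef_zero _ h)).
by apply: eq_bigr => i _; rewrite coef_const_mul hshiftE ifT //; lra.
Qed.

End RandomSeries.

Theorem corollary1p5 (R : realType) (K : fieldType) (K_char0 : [pchar K] =i pred0)
    (n : nat) (n_ge1 : (1 <= n)%N) (b : hahn R K) (bP : P_omega_pow n b)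
    (b_random : random b) :
  irreducible b.
Proof.
have [bn bx b0] := P_omega_pow_rank n_ge1 bP.
have b_neq0 : b != 0.
  by apply/eqP => bE; apply: bn.2; rewrite bE; apply: hrank_lt0.
split=> // [|y z byz].
  apply/negP => /unitrP[c [cb _]]; have := coefM0 c b.
  rewrite cb b0 mulr0 /= /one_coef eqxx => /eqP; apply/negP; exact: oner_neq0.
rewrite byz in bn bx.
have [p [q [yp zq pq yc zc]]] := nat_rank_factor K_char0 bn bx.
have unit_const (f : hahn R K) : f != 0 -> f = const (f 0) -> f \is a GRing.unit.
  move=> f0 fE; rewrite fE; apply: const_unit; apply: contraNneq f0 => f00.
  by rewrite fE f00; apply/eqP/hahnP => g /=; rewrite if_same.
have [y0 z0] : y != 0 /\ z != 0.
  by split; apply: contraNneq b_neq0 => E; rewrite byz E ?mulr0 ?mul0r.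
case: p yp pq yc => [|p] yp pq yc; first by left; apply: unit_const (yc erefl).
case: q zq pq zc => [|q] zq pq zc; first by right; apply: unit_const (zc erefl).
exfalso; rewrite -byz in bn.
have nE : n = (p + q).+2 by rewrite -pq addSn addnS.
(* Case (a) excludes the point 0; its rank is [n], which is now at least 2. *)
have rank1 x : rank_eq natlt b 1 x -> x != 0.
  move=> b1; apply/eqP => x0; rewrite x0 in b1.
  by have := rank_eq_inj nat_value_order b1 bn; rewrite nE.
have base := random_independent_germs K_char0 b0 b_random rank1.
rewrite nE in bn.
(* The one-point family at 0 with scalar 1: its combination is [b] itself, a product of germs of
   positive rank. *)
apply: (independent_not_decomposable base (I := unit) (P := xpredT)
  (lam := fun=> 1) (x := fun=> 0)) => [[] [] //||i _|].
- by exists tt.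
- by split; [exact: oner_neq0|exact: bn].
rewrite big_const card_unit /= addr0 const1 mul1r hshift0 byz.
by apply: (DecMul (p := p.+1) (q := q.+1)); rewrite ?addSn ?addnS //; [case: yp|case: zq].
Qed.
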